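(* Let $n\geqslant 1$, let $A,B\in\mathbb{C}$, let $\eta>0$, and let $$L=\frac{\partial}{\partial t}-\eta^2\sum_{j=1}^{n}\frac{\partial^2}{\partial x_j^2}$$ on $\mathbb{T}^{n+1}$ with coordinates $(t,x)=(t,x_1,\dots,x_n)$. Then the operator $P$ given by $Pu=Lu-Au-B\bar u$ is solvable and globally hypoelliptic.
   Context: For $N\geqslant1$, $\mathbb{T}^N\simeq\mathbb{R}^N/2\pi\mathbb{Z}^N$ is the $N$-dimensional torus, $\mathcal{C}^\infty(\mathbb{T}^N)$ is the space of smooth complex-valued functions on it, and $\mathscr{D}'(\mathbb{T}^N)$ is the space of distributions on it. Here $N=n+1$. The operator $P$ maps $\mathcal{C}^\infty(\mathbb{T}^N)$ to itself and extends to $\mathscr{D}'(\mathbb{T}^N)$ in the usual way, where $\bar u$ denotes the complex conjugate distribution, $\langle\bar u,\varphi\rangle=\overline{\langle u,\bar\varphi\rangle}$. Solvability: the operator $P:\mathcal{C}^\infty(\mathbb{T}^N)\to\mathcal{C}^\infty(\mathbb{T}^N)$ is called solvable if there exists a subspace $\mathcal{F}\subset\mathcal{C}^\infty(\mathbb{T}^N)$ of finite codimension such that for all $f\in\mathcal{F}$ there exists $u\in\mathcal{C}^\infty(\mathbb{T}^N)$ with $Pu=f$. Global hypoellipticity: $P$ is called globally hypoelliptic if $u\in\mathscr{D}'(\mathbb{T}^N)$ and $Pu\in\mathcal{C}^\infty(\mathbb{T}^N)$ imply $u\in\mathcal{C}^\infty(\mathbb{T}^N)$. *)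

(* Defs.v *)
(* Stdlib reals with Coquelicot. MathComp is only used for ordinals, sequences and
   iterated operators; it is imported last so that %N delimits its nat_scope. *)
From Stdlib Require Import Reals Lra FunctionalExtensionality ProofIrrelevance.
From Coquelicot Require Import Coquelicot.
From mathcomp Require Import ssreflect ssrfun ssrbool eqtype ssrnat seq fintype bigop.

Set Implicit Arguments.
Unset Strict Implicit.
Unset Printing Implicit Defensive.

#[local] Obligation Tactic := idtac.

Lemma locally_Re_Im (T : Type) (F : (T -> Prop) -> Prop) (h : T -> C) (z : C) :
  Filter F -> filterlim (fun t => Re (h t)) F (locally (Re z)) ->
  filterlim (fun t => Im (h t)) F (locally (Im z)) -> filterlim h F (locally z).
Proof.
move=> FF hr hi; apply/filterlim_locally => e.
move/filterlim_locally: hr => /(_ e) hr; move/filterlim_locally: hi => /(_ e) hi.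
by apply: filter_imp (filter_and _ _ hr hi) => y [h1 h2]; split.
Qed.

Section PartialDerivatives.
Variable N : nat.

(* As an index-to-real function type this carries Coquelicot's sup-norm uniform
   structure, so [continuous] on it is joint continuity. *)
Definition vec := 'I_N -> R.

Definition upd (x : vec) (j : 'I_N) (s : R) : vec :=
  fun i => if i == j then s else x i.

Definition ex_partial (j : 'I_N) (f : vec -> C) (x : vec) : Prop :=
  ex_derive (fun s => Re (f (upd x j s))) (x j) /\
  ex_derive (fun s => Im (f (upd x j s))) (x j).

Definition partial (j : 'I_N) (f : vec -> C) : vec -> C := fun x =>
  (Derive (fun s => Re (f (upd x j s))) (x j),
   Derive (fun s => Im (f (upd x j s))) (x j)).

(* partials [:: j1; ...; jk] f = d_{j1} ... d_{jk} f *)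
Definition partials (s : seq 'I_N) (f : vec -> C) : vec -> C :=
  foldr partial f s.

Definition smooth (f : vec -> C) : Prop :=
  forall (s : seq 'I_N) (x : vec),
    continuous (partials s f) x /\ forall j, ex_partial j (partials s f) x.

Definition periodic (f : vec -> C) : Prop :=
  forall (k : 'I_N -> Z) (x : vec),
    f (fun i => (x i + 2 * PI * IZR (k i))%R) = f x.

(* Integral over [0,2 PI]^N, one coordinate at a time; the base point is
   irrelevant since every coordinate gets integrated out. *)
Definition torus_int (f : vec -> C) : C :=
  foldr (fun (j : 'I_N) (g : vec -> C) (x : vec) =>
           RInt (V := C_R_CompleteNormedModule)
             (fun s => g (upd x j s)) 0 (2 * PI))
        f (enum 'I_N) (fun _ => 0%R).

Lemma continuous_ReIm (f : vec -> C) (x : vec) :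
  continuous (fun y => Re (f y)) x -> continuous (fun y => Im (f y)) x ->
  continuous f x.
Proof. exact: locally_Re_Im. Qed.

Lemma continuous_Re (f : vec -> C) (x : vec) :
  continuous f x -> continuous (fun y => Re (f y)) x.
Proof. by move=> h; apply: (continuous_comp f fst) => //; apply: continuous_fst. Qed.

Lemma continuous_Im (f : vec -> C) (x : vec) :
  continuous f x -> continuous (fun y => Im (f y)) x.
Proof. by move=> h; apply: (continuous_comp f snd) => //; apply: continuous_snd. Qed.

(* Sums, complex multiples and conjugates are all of this form. *)
Definition rlin (a b c d a' b' c' d' : R) (f g : vec -> C) : vec -> C := fun x =>
  ((a * Re (f x) + b * Im (f x) + (c * Re (g x) + d * Im (g x)))%R,
   (a' * Re (f x) + b' * Im (f x) + (c' * Re (g x) + d' * Im (g x)))%R).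

Lemma is_derive_lin4 (a b c d : R) (f1 f2 g1 g2 : R -> R) (t : R) :
  ex_derive f1 t -> ex_derive f2 t -> ex_derive g1 t -> ex_derive g2 t ->
  is_derive (fun s => a * f1 s + b * f2 s + (c * g1 s + d * g2 s))%R t
    (a * Derive f1 t + b * Derive f2 t + (c * Derive g1 t + d * Derive g2 t))%R.
Proof.
move=> h1 h2 h3 h4; by auto_derive => //=; rewrite !Rmult_1_l.
Qed.

Lemma partial_rlin a b c d a' b' c' d' f g j x :
  ex_partial j f x -> ex_partial j g x ->
  ex_partial j (rlin a b c d a' b' c' d' f g) x /\
  partial j (rlin a b c d a' b' c' d' f g) x =
  rlin a b c d a' b' c' d' (partial j f) (partial j g) x.
Proof.
move=> [h1 h2] [h3 h4]; rewrite /ex_partial /partial /rlin /=.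
have H1 := is_derive_lin4 a b c d h1 h2 h3 h4.
have H2 := is_derive_lin4 a' b' c' d' h1 h2 h3 h4.
split; first by split; eexists; [exact: H1 | exact: H2].
by congr (_, _); apply: is_derive_unique.
Qed.

Lemma partials_rlin a b c d a' b' c' d' f g s : smooth f -> smooth g ->
  partials s (rlin a b c d a' b' c' d' f g) =
  rlin a b c d a' b' c' d' (partials s f) (partials s g).
Proof.
move=> hf hg; elim: s => [//|j s /= ->].
apply: functional_extensionality => x.
by apply: (proj2 (partial_rlin _ _ _ _ _ _ _ _ _ _)); [apply hf | apply hg].
Qed.

Lemma continuous_rlin4 (a b c d : R) (f g : vec -> C) (x : vec) :
  continuous f x -> continuous g x ->
  continuous (fun y => a * Re (f y) + b * Im (f y) +
                       (c * Re (g y) + d * Im (g y)))%R x.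
Proof.
move=> hf hg.
have h1 := continuous_Re hf; have h2 := continuous_Im hf.
have h3 := continuous_Re hg; have h4 := continuous_Im hg.
have sc (k : R) (h : vec -> R) :
    continuous h x -> continuous (fun y => (k * h y)%R) x.
  by move=> H; apply: (continuous_scal_r k h).
have ad (h h' : vec -> R) : continuous h x -> continuous h' x ->
    continuous (fun y => (h y + h' y)%R) x.
  by move=> H H'; apply: (continuous_plus h h').
by apply: (ad); apply: (ad); apply: (sc).
Qed.

Lemma smooth_rlin a b c d a' b' c' d' f g : smooth f -> smooth g ->
  smooth (rlin a b c d a' b' c' d' f g).
Proof.
move=> hf hg s x; rewrite partials_rlin //; split.
  by apply: continuous_ReIm; apply: continuous_rlin4; [apply hf|apply hg|apply hf|apply hg].
by move=> j; apply: (proj1 (partial_rlin _ _ _ _ _ _ _ _ _ _)); [apply hf | apply hg].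
Qed.

Lemma periodic_rlin a b c d a' b' c' d' f g : periodic f -> periodic g ->
  periodic (rlin a b c d a' b' c' d' f g).
Proof. by move=> hf hg k x; rewrite /rlin hf hg. Qed.

Lemma plus_rlin (f g : vec -> C) :
  (fun x => f x + g x)%C = rlin 1 0 1 0 0 1 0 1 f g.
Proof.
apply: functional_extensionality => x.
by rewrite /rlin /Cplus /Re /Im; congr (_, _) => /=; ring.
Qed.

Lemma scal_rlin (k : C) (f : vec -> C) :
  (fun x => k * f x)%C = rlin (Re k) (- Im k) 0 0 (Im k) (Re k) 0 0 f f.
Proof.
apply: functional_extensionality => x.
by rewrite /rlin /Cmult /Re /Im; congr (_, _) => /=; ring.
Qed.

Lemma conj_rlin (f : vec -> C) :
  (fun x => Cconj (f x)) = rlin 1 0 0 0 0 (-1) 0 0 f f.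
Proof.
apply: functional_extensionality => x.
by rewrite /rlin /Cconj /Re /Im; congr (_, _) => /=; ring.
Qed.

Lemma smooth_zero : smooth (fun _ => RtoC 0).
Proof.
have E s : partials s (fun _ => RtoC 0) = (fun _ => RtoC 0).
  elim: s => [//|j s /= ->]; apply: functional_extensionality => x.
  by rewrite /partial /= !Derive_const.
move=> s x; rewrite E; split; first exact: continuous_const.
by move=> j; split; exact: ex_derive_const.
Qed.

Lemma smooth_plus f g : smooth f -> smooth g -> smooth (fun x => f x + g x)%C.
Proof. by rewrite plus_rlin; apply: smooth_rlin. Qed.

Lemma smooth_scal k f : smooth f -> smooth (fun x => k * f x)%C.
Proof. by rewrite scal_rlin => h; apply: smooth_rlin. Qed.

Lemma smooth_conj f : smooth f -> smooth (fun x => Cconj (f x)).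
Proof. by rewrite conj_rlin => h; apply: smooth_rlin. Qed.

Lemma smooth_partial j f : smooth f -> smooth (partial j f).
Proof.
by move=> h s; have := h (rcons s j); rewrite /partials foldr_rcons.
Qed.

Lemma periodic_partial j f : periodic f -> periodic (partial j f).
Proof.
move=> h k x.
set y := fun i : 'I_N => _.
have E (p : C -> R) : Derive (fun s => p (f (upd y j s))) (y j) =
                      Derive (fun s => p (f (upd x j s))) (x j).
  rewrite /Derive; congr (real _); apply: Lim_ext => e; congr (_ / _)%R.
  have F r : f (upd y j (y j + r)%R) = f (upd x j (x j + r)%R).
    rewrite -(h k (upd x j (x j + r)%R)); congr f.
    apply: functional_extensionality => i; rewrite /upd /y.
    by case: eqP => // ->; ring.
  have := F 0%R; rewrite !Rplus_0_r => ->.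
  by rewrite F.
by rewrite /partial E E.
Qed.

End PartialDerivatives.

(* C^oo(T^N), identified with the smooth 2 PI Z^N-periodic functions on R^N. *)
Record Cinf (N : nat) := mkCinf {
  cfun :> vec N -> C;
  cfun_smooth : smooth cfun;
  cfun_periodic : periodic cfun }.

Lemma Cinf_ext (N : nat) (f g : Cinf N) : (forall x, f x = g x) -> f = g.
Proof.
case: f g => [f hf pf] [g hg pg] /= /functional_extensionality E.
by subst g; congr mkCinf; apply: proof_irrelevance.
Qed.

Section CinfModule.
Variable N : nat.
Implicit Types f g : Cinf N.

Definition Cinf_zero : Cinf N :=
  @mkCinf N (fun _ => RtoC 0) (@smooth_zero N) (fun _ _ => erefl).

Program Definition Cinf_plus f g : Cinf N :=
  @mkCinf N (fun x => f x + g x)%C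
    (smooth_plus (cfun_smooth f) (cfun_smooth g)) _.
Next Obligation. by move=> f g k x; rewrite !cfun_periodic. Qed.

Program Definition Cinf_scal (c : C) f : Cinf N :=
  @mkCinf N (fun x => c * f x)%C (smooth_scal c (cfun_smooth f)) _.
Next Obligation. by move=> c f k x; rewrite cfun_periodic. Qed.

Definition Cinf_opp f : Cinf N := Cinf_scal (- (1))%C f.

Program Definition Cinf_conj f : Cinf N :=
  @mkCinf N (fun x => Cconj (f x)) (smooth_conj (cfun_smooth f)) _.
Next Obligation. by move=> f k x; rewrite cfun_periodic. Qed.

Definition Cinf_partial (j : 'I_N) f : Cinf N :=
  mkCinf (smooth_partial j (cfun_smooth f))
         (periodic_partial j (cfun_periodic f)).

Lemma Cinf_plusC f g : Cinf_plus f g = Cinf_plus g f.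
Proof. by apply: Cinf_ext => x /=; ring. Qed.
Lemma Cinf_plusA f g h :
  Cinf_plus f (Cinf_plus g h) = Cinf_plus (Cinf_plus f g) h.
Proof. by apply: Cinf_ext => x /=; ring. Qed.
Lemma Cinf_plus0 f : Cinf_plus f Cinf_zero = f.
Proof. by apply: Cinf_ext => x /=; ring. Qed.
Lemma Cinf_plusN f : Cinf_plus f (Cinf_opp f) = Cinf_zero.
Proof. by apply: Cinf_ext => x /=; ring. Qed.

Definition Cinf_AbelianMonoid_mixin :=
  AbelianMonoid.Mixin (Cinf N) Cinf_plus Cinf_zero
    Cinf_plusC Cinf_plusA Cinf_plus0.
Canonical Cinf_AbelianMonoid :=
  AbelianMonoid.Pack (Cinf N) Cinf_AbelianMonoid_mixin (Cinf N).
Definition Cinf_AbelianGroup_mixin :=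
  AbelianGroup.Mixin Cinf_AbelianMonoid Cinf_opp Cinf_plusN.
Canonical Cinf_AbelianGroup :=
  AbelianGroup.Pack (Cinf N)
    (AbelianGroup.Class (Cinf N) Cinf_AbelianMonoid_mixin
       Cinf_AbelianGroup_mixin) (Cinf N).

Lemma Cinf_scalA (a b : C) f :
  Cinf_scal a (Cinf_scal b f) = Cinf_scal (a * b)%C f.
Proof. by apply: Cinf_ext => x /=; ring. Qed.
Lemma Cinf_scal1 f : Cinf_scal (RtoC 1) f = f.
Proof. by apply: Cinf_ext => x /=; ring. Qed.
Lemma Cinf_scalDr (a : C) f g :
  Cinf_scal a (Cinf_plus f g) = Cinf_plus (Cinf_scal a f) (Cinf_scal a g).
Proof. by apply: Cinf_ext => x /=; ring. Qed.
Lemma Cinf_scalDl (a b : C) f :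
  Cinf_scal (a + b)%C f = Cinf_plus (Cinf_scal a f) (Cinf_scal b f).
Proof. by apply: Cinf_ext => x /=; ring. Qed.

Definition Cinf_ModuleSpace_mixin :=
  ModuleSpace.Mixin C_Ring Cinf_AbelianGroup Cinf_scal
    Cinf_scalA Cinf_scal1 Cinf_scalDr Cinf_scalDl.
Canonical Cinf_ModuleSpace :=
  ModuleSpace.Pack C_Ring (Cinf N)
    (ModuleSpace.Class C_Ring (Cinf N) _ Cinf_ModuleSpace_mixin) (Cinf N).

(* Neighbourhood filter of f in the usual Frechet topology of C^oo(T^N): uniform
   convergence of all partial derivatives. *)
Definition Cinf_nbhs f : (Cinf N -> Prop) -> Prop := fun U =>
  exists (k : nat) (d : posreal), forall g : Cinf N,
    (forall (s : seq 'I_N) (x : vec N), (size s <= k)%N ->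
       (Cmod (partials s g x - partials s f x)%C < d)%R) -> U g.

Global Instance Cinf_nbhs_filter f : Filter (Cinf_nbhs f).
Proof.
split.
- by exists 0%N, (mkposreal 1 Rlt_0_1).
- move=> P Q [k [d hP]] [k' [d' hQ]].
  exists (maxn k k'), (mkposreal _ (Rmin_stable_in_posreal d d')) => g hg; split.
  + apply: hP => s x hs; apply: Rlt_le_trans (Rmin_l d d').
    by apply: hg; rewrite leq_max hs.
  + apply: hQ => s x hs; apply: Rlt_le_trans (Rmin_r d d').
    by apply: hg; rewrite leq_max hs orbT.
- by move=> P Q PQ [k [d hP]]; exists k, d => g /hP /PQ.
Qed.

Lemma Cinf_partial_cont j f :
  filterlim (Cinf_partial j) (Cinf_nbhs f) (Cinf_nbhs (Cinf_partial j f)).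
Proof.
move=> U [k [d hU]]; exists k.+1, d => g hg; apply: hU => s x hs.
have := hg (rcons s j) x; rewrite size_rcons ltnS => /(_ hs).
by rewrite /partials !foldr_rcons.
Qed.

Lemma Cinf_conj_cont f :
  filterlim Cinf_conj (Cinf_nbhs f) (Cinf_nbhs (Cinf_conj f)).
Proof.
have E (h : Cinf N) s x : partials s (Cinf_conj h) x = Cconj (partials s h x).
  have := conj_rlin h; rewrite /= => ->; rewrite partials_rlin; try exact: cfun_smooth.
  by rewrite -conj_rlin.
move=> U [k [d hU]]; exists k, d => g hg; apply: hU => s x hs.
by rewrite !E -Cminus_conj Cmod_conj; apply: hg.
Qed.

Lemma Cinf_partialD j f g :
  Cinf_partial j (plus f g) = plus (Cinf_partial j f) (Cinf_partial j g).
Proof.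
apply: Cinf_ext => x /=; rewrite plus_rlin.
have := @partials_rlin N 1 0 1 0 0 1 0 1 f g [:: j].
by rewrite /= => ->; [rewrite -plus_rlin | exact: cfun_smooth ..].
Qed.

Lemma Cinf_partialZ j c f :
  Cinf_partial j (scal c f) = scal c (Cinf_partial j f).
Proof.
apply: Cinf_ext => x /=; rewrite scal_rlin.
have := @partials_rlin N (Re c) (- Im c) 0 0 (Im c) (Re c) 0 0 f f [:: j].
by rewrite /= => ->; [rewrite -scal_rlin | exact: cfun_smooth ..].
Qed.

Lemma Cinf_conjD f g :
  Cinf_conj (plus f g) = plus (Cinf_conj f) (Cinf_conj g).
Proof. by apply: Cinf_ext => x /=; rewrite Cplus_conj. Qed.

Lemma Cinf_conjZ c f :
  Cinf_conj (scal c f) = scal (Cconj c) (Cinf_conj f).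
Proof. by apply: Cinf_ext => x /=; rewrite Cmult_conj. Qed.

End CinfModule.

(* Distributions on T^N: continuous complex-linear functionals on C^oo(T^N). *)
Record distr (N : nat) := mkDistr {
  dfun :> Cinf N -> C;
  dfun_plus : forall f g, dfun (plus f g) = (dfun f + dfun g)%C;
  dfun_scal : forall (c : C) f, dfun (scal c f) = (c * dfun f)%C;
  dfun_cont : forall f, filterlim dfun (Cinf_nbhs f) (locally (dfun f)) }.

Lemma distr_ext (N : nat) (u v : distr N) : (forall f, u f = v f) -> u = v.
Proof.
case: u v => [u h1 h2 h3] [v k1 k2 k3] /= /functional_extensionality E.
by subst v; congr mkDistr; apply: proof_irrelevance.
Qed.

Section DistrModule.
Variable N : nat.
Implicit Types u v : distr N.

Program Definition distr_zero : distr N := @mkDistr N (fun _ => RtoC 0) _ _ _.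
Next Obligation. by move=> f g /=; ring. Qed.
Next Obligation. by move=> c f /=; ring. Qed.
Next Obligation. by move=> f; apply: filterlim_const. Qed.

Program Definition distr_plus u v : distr N :=
  @mkDistr N (fun f => u f + v f)%C _ _ _.
Next Obligation. by move=> u v f g; cbv beta; rewrite !dfun_plus; ring. Qed.
Next Obligation. by move=> u v c f; cbv beta; rewrite !dfun_scal; ring. Qed.
Next Obligation.
move=> u v f.
eapply (filterlim_comp_2 _ _ _ (@dfun_cont N u f) (@dfun_cont N v f)).
exact: (@filterlim_plus R_AbsRing C_R_NormedModule (u f) (v f)).
Qed.

Program Definition distr_scal (c : C) u : distr N :=
  @mkDistr N (fun f => c * u f)%C _ _ _.
Next Obligation. by move=> c u f g; cbv beta; rewrite dfun_plus; ring. Qed.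
Next Obligation. by move=> c u a f; cbv beta; rewrite dfun_scal; ring. Qed.
Next Obligation.
move=> c u f; eapply (filterlim_comp _ _ _ _ _ _ _ _ (@dfun_cont N u f)).
exact: (@filterlim_scal_r C_AbsRing C_NormedModule c (u f)).
Qed.

Definition distr_opp u : distr N := distr_scal (- (1))%C u.

(* <d_j u, f> = - <u, d_j f> *)
Program Definition distr_partial (j : 'I_N) u : distr N :=
  @mkDistr N (fun f => - (1) * u (Cinf_partial j f))%C _ _ _.
Next Obligation.
by move=> j u f g; cbv beta; rewrite Cinf_partialD dfun_plus; ring.
Qed.
Next Obligation.
by move=> j u c f; cbv beta; rewrite Cinf_partialZ dfun_scal; ring.
Qed.
Next Obligation.
move=> j u f.
eapply (filterlim_comp _ _ _ _ _ _ _ _ (filterlim_comp _ _ _ _ _ _ _ _ (@Cinf_partial_cont N j f)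
                                       (@dfun_cont N u _))).
exact: (@filterlim_scal_r C_AbsRing C_NormedModule (- (1))%C).
Qed.

(* <conj u, f> = conj <u, conj f> *)
Program Definition distr_conj u : distr N :=
  @mkDistr N (fun f => Cconj (u (Cinf_conj f))) _ _ _.
Next Obligation.
by move=> u f g; cbv beta; rewrite Cinf_conjD dfun_plus Cplus_conj.
Qed.
Next Obligation.
by move=> u c f; cbv beta; rewrite Cinf_conjZ dfun_scal Cmult_conj Cconj_conj.
Qed.
Next Obligation.
move=> u f.
eapply (filterlim_comp _ _ _ _ _ _ _ _ (filterlim_comp _ _ _ _ _ _ _ _ (@Cinf_conj_cont N f) (@dfun_cont N u _))).
set z := u _; apply: locally_Re_Im.
- by apply: continuous_fst.
- apply: (continuous_comp snd Ropp); first exact: continuous_snd.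
  exact: (continuous_opp id).
Qed.

Lemma distr_plusC u v : distr_plus u v = distr_plus v u.
Proof. by apply: distr_ext => f /=; ring. Qed.
Lemma distr_plusA u v w :
  distr_plus u (distr_plus v w) = distr_plus (distr_plus u v) w.
Proof. by apply: distr_ext => f /=; ring. Qed.
Lemma distr_plus0 u : distr_plus u distr_zero = u.
Proof. by apply: distr_ext => f /=; ring. Qed.
Lemma distr_plusN u : distr_plus u (distr_opp u) = distr_zero.
Proof. by apply: distr_ext => f /=; ring. Qed.

Definition distr_AbelianMonoid_mixin :=
  AbelianMonoid.Mixin (distr N) distr_plus distr_zero
    distr_plusC distr_plusA distr_plus0.
Canonical distr_AbelianMonoid :=
  AbelianMonoid.Pack (distr N) distr_AbelianMonoid_mixin (distr N).
Definition distr_AbelianGroup_mixin :=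
  AbelianGroup.Mixin distr_AbelianMonoid distr_opp distr_plusN.
Canonical distr_AbelianGroup :=
  AbelianGroup.Pack (distr N)
    (AbelianGroup.Class (distr N) distr_AbelianMonoid_mixin
       distr_AbelianGroup_mixin) (distr N).

Lemma distr_scalA (a b : C) u :
  distr_scal a (distr_scal b u) = distr_scal (a * b)%C u.
Proof. by apply: distr_ext => f /=; ring. Qed.
Lemma distr_scal1 u : distr_scal (RtoC 1) u = u.
Proof. by apply: distr_ext => f /=; ring. Qed.
Lemma distr_scalDr (a : C) u v :
  distr_scal a (distr_plus u v) = distr_plus (distr_scal a u) (distr_scal a v).
Proof. by apply: distr_ext => f /=; ring. Qed.
Lemma distr_scalDl (a b : C) u :
  distr_scal (a + b)%C u = distr_plus (distr_scal a u) (distr_scal b u).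
Proof. by apply: distr_ext => f /=; ring. Qed.

Definition distr_ModuleSpace_mixin :=
  ModuleSpace.Mixin C_Ring distr_AbelianGroup distr_scal
    distr_scalA distr_scal1 distr_scalDr distr_scalDl.
Canonical distr_ModuleSpace :=
  ModuleSpace.Pack C_Ring (distr N)
    (ModuleSpace.Class C_Ring (distr N) _ distr_ModuleSpace_mixin) (distr N).

End DistrModule.

(* u in C^oo(T^N), under the embedding f |-> (phi |-> int f phi). *)
Definition distr_smooth (N : nat) (u : distr N) : Prop :=
  exists f : Cinf N, forall phi : Cinf N,
    u phi = torus_int (fun x => f x * phi x)%C.

Definition subspace (K : Ring) (V : ModuleSpace K) (F : V -> Prop) : Prop :=
  F zero /\ (forall u v, F u -> F v -> F (plus u v)) /\
  (forall (c : K) u, F u -> F (scal c u)).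

(* V / F is spanned by finitely many classes. *)
Definition finite_codim (K : Ring) (V : ModuleSpace K) (F : V -> Prop) : Prop :=
  exists (m : nat) (g : 'I_m -> V), forall v : V, exists c : 'I_m -> K,
    F (minus v (\big[plus/zero]_(i < m) scal (c i) (g i))).

(* Subspaces are complex subspaces. Operators such as u |-> conj u are only
   real-linear, but a real subspace F of finite codimension contains the complex
   subspace F \cap iF, again of finite codimension, so the notion is unchanged
   if real subspaces are used. *)
Definition solvable (N : nat) (P : Cinf N -> Cinf N) : Prop :=
  exists F : Cinf N -> Prop,
    subspace F /\ finite_codim F /\
    forall f, F f -> exists u : Cinf N, P u = f.

Definition globally_hypoelliptic (N : nat) (P : distr N -> distr N) : Prop :=
  forall u : distr N, distr_smooth (P u) -> distr_smooth u.

(* Common to functions and distributions: V is the space, d its partial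
   derivatives and cj its conjugation. Coordinate 0 is t, coordinate j+1 is x_j. *)
Section HeatVekua.
Variables (n : nat) (V : ModuleSpace C_Ring).
Variables (d : 'I_n.+1 -> V -> V) (cj : V -> V).

Definition heat_op (eta : R) (u : V) : V :=
  minus (d ord0 u)
    (scal (RtoC (eta ^ 2))
       (\big[plus/zero]_(j < n) d (lift ord0 j) (d (lift ord0 j) u))).

Definition heat_vekua_op (eta : R) (A B : C) (u : V) : V :=
  minus (minus (heat_op eta u) (scal A u)) (scal B (cj u)).

End HeatVekua.

Definition Cinf_heat_vekua (n : nat) (eta : R) (A B : C) :
    Cinf n.+1 -> Cinf n.+1 :=
  heat_vekua_op (@Cinf_partial n.+1) (@Cinf_conj n.+1) eta A B.

Definition distr_heat_vekua (n : nat) (eta : R) (A B : C) :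
    distr n.+1 -> distr n.+1 :=
  heat_vekua_op (@distr_partial n.+1) (@distr_conj n.+1) eta A B.

(* Main.v *)
(* On Fourier coefficients the equation P u = f couples only the frequencies k
   and -k: with sigma(k) = i tau + eta^2 |xi|^2 for k = (tau, xi),
     (sigma(k) - A) a(k) - B conj(a(-k)) = F(k).
   Since sigma(-k) = conj(sigma(k)), conjugating the equation at -k gives a 2x2
   linear system for a(k) and conj(a(-k)), and adding the two triangle
   inequalities yields
     (|sigma(k)| - |A| - |B|) (|a(k)| + |a(-k)|) <= |F(k)| + |F(-k)|.
   As |sigma(k)| tends to infinity, a decays as fast as F, which is
   hypoellipticity; and the system is uniquely solvable for all but finitely many
   k, so that the range of P contains every function whose coefficients at those
   exceptional k vanish.

   Smooth functions correspond to rapidly decreasing coefficients, and their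
   Fourier series converge in C^oo. Injectivity of the coefficients is
   reduced to one variable by integrating out the coordinates one after the
   other; there it follows by testing against (1 + cos (s - x))^n, which
   concentrates at x. *)
Require Import Defs.
From Stdlib Require Import Reals ZArith Lra Lia Cantor FunctionalExtensionality Classical IndefiniteDescription.
From Coquelicot Require Import Coquelicot.
From HB Require Import structures.
From mathcomp Require Import ssreflect ssrfun ssrbool eqtype ssrnat seq fintype bigop.

Set Implicit Arguments.
Unset Strict Implicit.
Unset Printing Implicit Defensive.

Local Open Scope R_scope.

(** * Iterated integrals over the torus *)

(** The a priori estimate is pointwise in the pair {k, -k}: above a threshold frequency it bounds
    a(k) by F, and below it only finitely many values occur. Hence it applies to any family solving
    the system, in particular to the values of an arbitrary distribution on exponentials, and it
    also supplies the decay of the solution built for solvability.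

    The length lies in the passage between coefficients and functions. Integrals are iterated in the
    fixed order of [enum], so arguments about one coordinate are arranged to respect that order.
    Differentiation is handled through second-order Taylor remainders that are uniform in the base
    point: such a bound survives integration and limits, so it yields both the coefficients of a
    derivative and the differentiability of a limit in C^oo. Convergence is recorded as a rate
    C/(M+1); it comes from terms of size 1/((m+1)(m+2)), which telescope, and an explicit rate lets
    limits be taken by comparing constants. *)

(** A Lebesgue number for the cover of [a,b] by the balls on which [Q] is known. It is the only
    compactness used in several variables: it turns local statements along a slice into ones with a
    single radius. *)
Lemma lebesgue_number_1d (a b : R) (Q : R -> posreal -> Prop) :
  (forall t, a <= t <= b -> exists d : posreal, Q t d) ->
  exists d : posreal, forall s, a <= s <= b ->
    exists t (e : posreal), a <= t <= b /\ Q t e /\ Rabs (s - t) < e /\ d <= e.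
Proof.
move=> h.
have /functional_choice [D hD] :
    forall t, exists d : posreal, a <= t <= b -> Q t d.
  move=> t; case: (classic (a <= t <= b)) => [/h [d hd]|ht]; first by exists d.
  by exists (mkposreal 1 Rlt_0_1).
case: (compactness_value_1d a b D) => d hd; exists d => s /hd /NNPP [t [ht [h1 h2]]].
by exists t, (D t); split => //; split; first exact: hD.
Qed.

Section IteratedIntegrals.
Variable N : nat.
Implicit Types (f g : vec N -> R) (x y : vec N) (l : seq 'I_N).

Lemma upd_upd x j s t : upd (upd x j s) j t = upd x j t.
Proof. by apply: functional_extensionality => i; rewrite /upd; case: eqP. Qed.

Lemma updC x i j s t : i != j -> upd (upd x i s) j t = upd (upd x j t) i s.
Proof.
move=> ij; apply: functional_extensionality => k; rewrite /upd.
by case: (k =P j) => // ->; rewrite eq_sym (negbTE ij).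
Qed.

Lemma upd_id x j : upd x j (x j) = x.
Proof. by apply: functional_extensionality => i; rewrite /upd; case: eqP => // ->. Qed.

Lemma upd_same x j s : upd x j s j = s.
Proof. by rewrite /upd eqxx. Qed.

Lemma ballP x y (e : R) : (forall i, Rabs (y i - x i) < e) -> ball x e y.
Proof. by move=> h i; exact: h. Qed.

Lemma continuous_coord (j : 'I_N) x : continuous (fun y : vec N => y j) x.
Proof. by apply/filterlim_locally => e; exists e => y; apply. Qed.

Lemma continuous_upd x j t : continuous (fun s => upd x j s) t.
Proof.
apply/filterlim_locally => e; exists e => s hs i; rewrite /upd.
by case: eqP => // _; exact: ball_center.
Qed.

Definition ctn f := forall x, continuous f x.

Lemma ctn_slice f x j : ctn f -> forall t, continuous (fun s => f (upd x j s)) t.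
Proof.
by move=> hf t; apply: (continuous_comp (fun s => upd x j s) f); [exact: continuous_upd|exact: hf].
Qed.

Lemma ex_RInt_slice f x j a b : ctn f -> ex_RInt (fun s => f (upd x j s)) a b.
Proof. by move=> hf; apply: (@ex_RInt_continuous R_CompleteNormedModule) => t _; exact: ctn_slice. Qed.

Definition cint (j : 'I_N) f x : R := RInt (fun s => f (upd x j s)) 0 (2 * PI).

Definition iint l f : vec N -> R := foldr cint f l.

Lemma twoPI_gt0 : 0 < 2 * PI.
Proof. have := PI_RGT_0; lra. Qed.

(** By compactness of the slice, a single radius makes [f] nearly constant around every point of
    it. *)
Lemma ctn_cint j f : ctn f -> ctn (cint j f).
Proof.
move=> hf x; apply/filterlim_locally => eps.
have P := twoPI_gt0.
(* Both integrands are compared with the value at a common centre, which costs [2 * e]; over the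
   length 2 PI this gives eps/2. *)
have e0 : 0 < eps / (4 * (2 * PI)) by apply: Rdiv_lt_0_compat; [exact: cond_pos|lra].
pose e := mkposreal _ e0.
have /lebesgue_number_1d [d hd] : forall t, 0 <= t <= 2 * PI -> exists d : posreal,
    forall y, ball (upd x j t) d y -> Rabs (f y - f (upd x j t)) < e.
  move=> t _; have /filterlim_locally /(_ e) [d hd] := hf (upd x j t).
  by exists d => y /hd.
exists d => y hy.
suff: Rabs (cint j f y - cint j f x) < eps by [].
rewrite /cint -[_ - _](@RInt_minus R_CompleteNormedModule); try exact: ex_RInt_slice.
apply: Rle_lt_trans (_ : (2 * PI - 0) * (2 * e) < _); last first.
  by rewrite /e /=; have := cond_pos eps => He; apply: (Rle_lt_trans _ (eps / 2)); [apply: Req_le; field; lra|lra].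
apply: abs_RInt_le_const; first lra.
  by apply: (@ex_RInt_minus R_NormedModule); exact: ex_RInt_slice.
move=> t /hd [t' [e' [_ [Q [h1 h2]]]]].
have B z : (forall i, Rabs (z i - x i) < d) -> Rabs (f (upd z j t) - f (upd x j t')) < e.
  move=> hz; apply: Q; apply: ballP => i; rewrite /upd; case: eqP => // _.
  exact: Rlt_le_trans (hz i) h2.
have B1 := B y hy.
have B2 : Rabs (f (upd x j t) - f (upd x j t')) < e.
  by apply: B => i; rewrite Rminus_diag Rabs_R0; exact: cond_pos.
change (Rabs (f (upd y j t) - f (upd x j t)) <= 2 * e).
have [? ?] := Rabs_def2 _ _ B1; have [? ?] := Rabs_def2 _ _ B2.
by apply: Rabs_le; lra.
Qed.

Lemma ctn_iint l f : ctn f -> ctn (iint l f).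
Proof. by move=> hf; elim: l => //= j l IH; exact: ctn_cint. Qed.

Lemma ctn_lin a b f g : ctn f -> ctn g -> ctn (fun x => a * f x + b * g x).
Proof.
move=> hf hg x; apply: (continuous_plus (fun x => a * f x) (fun x => b * g x)).
  exact: (continuous_scal_r a f).
exact: (continuous_scal_r b g).
Qed.

Lemma iint_lin l a b f g : ctn f -> ctn g ->
  iint l (fun x => a * f x + b * g x) = fun x => a * iint l f x + b * iint l g x.
Proof.
move=> hf hg; elim: l => //= j l ->; apply: functional_extensionality => x; rewrite /cint.
rewrite (@RInt_plus R_CompleteNormedModule (fun s => a * _) (fun s => b * _)).
- rewrite (@RInt_scal R_CompleteNormedModule (fun s => iint l f _)).
    rewrite (@RInt_scal R_CompleteNormedModule (fun s => iint l g _)) //.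
    by apply: ex_RInt_slice; exact: ctn_iint.
  by apply: ex_RInt_slice; exact: ctn_iint.
- by apply: (@ex_RInt_scal R_NormedModule); apply: ex_RInt_slice; exact: ctn_iint.
- by apply: (@ex_RInt_scal R_NormedModule); apply: ex_RInt_slice; exact: ctn_iint.
Qed.

Lemma iint_bound l f M : ctn f -> (forall x, Rabs (f x) <= M) ->
  forall x, Rabs (iint l f x) <= (2 * PI) ^ size l * M.
Proof.
move=> hf hM; elim: l => [|j l IH] x /=; first by rewrite Rmult_1_l.
rewrite Rmult_assoc -{1}(Rminus_0_r (2 * PI)); have P := twoPI_gt0.
apply: abs_RInt_le_const; first lra.
  by apply: ex_RInt_slice; exact: ctn_iint.
by move=> t _; exact: IH.
Qed.

Lemma iint_const l c : iint l (fun _ => c) = fun _ => (2 * PI) ^ size l * c.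
Proof.
elim: l => [|j l IH] /=; apply: functional_extensionality => x; first by rewrite Rmult_1_l.
by rewrite /cint IH RInt_const /scal /= /mult /=; ring.
Qed.

Lemma iint_weight l w f : ctn f -> (forall j x s, j \in l -> w (upd x j s) = w x) ->
  iint l (fun x => w x * f x) = fun x => w x * iint l f x.
Proof.
move=> hf; elim: l => //= j l IH hw; rewrite IH; last first.
  by move=> i x s il; apply: hw; rewrite inE il orbT.
apply: functional_extensionality => x; rewrite /cint.
rewrite (@RInt_ext _ _ (fun s => scal (w x) (iint l f (upd x j s)))); last first.
  by move=> s _; rewrite hw ?mem_head.
rewrite (@RInt_scal R_CompleteNormedModule) //.
by apply: ex_RInt_slice; exact: ctn_iint.
Qed.

Definition periodic_in j f := forall x s, f (upd x j (s + 2 * PI)) = f (upd x j s).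
Definition translate j (h : R) x := upd x j (x j + h).

Lemma translate_upd i j h x s : i != j -> translate j h (upd x i s) = upd (translate j h x) i s.
Proof.
move=> ij; rewrite /translate /upd; apply: functional_extensionality => k.
case: (k =P j) => [->|//]; by rewrite eq_sym (negbTE ij).
Qed.

Lemma iint_translate_notin l j h f : j \notin l ->
  iint l (fun x => f (translate j h x)) = fun x => iint l f (translate j h x).
Proof.
elim: l => //= i l IH; rewrite inE negb_or => /andP [ji jl]; rewrite IH //.
apply: functional_extensionality => x; rewrite /cint; apply: RInt_ext => s _.
by rewrite translate_upd // eq_sym.
Qed.

Lemma periodic_in_iint l i f : periodic_in i f -> periodic_in i (iint l f).
Proof.
move=> p; elim: l => //= j l IH x s; rewrite /cint.
case: (j =P i) => [->|/eqP ji].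
  by apply: RInt_ext => t _; rewrite !upd_upd.
by apply: RInt_ext => t _; rewrite !(@updC x i j) 1?eq_sym //; exact: IH.
Qed.

Lemma cint_translate j h f : ctn f -> periodic_in j f ->
  cint j (fun x => f (translate j h x)) = cint j f.
Proof.
move=> hf p; apply: functional_extensionality => x; rewrite /cint /translate.
pose F s := f (upd x j s).
have eF a b : ex_RInt F a b by exact: ex_RInt_slice.
have tr c a b : RInt (fun s => F (s + c)) a b = RInt F (a + c) (b + c).
  have := @RInt_comp_lin R_CompleteNormedModule F 1 c a b.
  rewrite !Rmult_1_l => <- //; apply: RInt_ext => s _.
  by rewrite Rmult_1_l /scal /= /mult /= Rmult_1_l.
transitivity (RInt (fun s => F (s + h)) 0 (2 * PI)).
  by apply: RInt_ext => s _; rewrite upd_upd upd_same.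
rewrite tr Rplus_0_l.
have <- : RInt F h (2 * PI + h) = RInt F 0 (2 * PI) => //.
(* The piece gained beyond 2 PI equals the piece lost at 0; the two Chasles relations do the rest,
   whatever the sign of [h]. *)
have e1 : RInt F 0 h = RInt F (2 * PI) (2 * PI + h).
  have := tr (2 * PI) 0 h; rewrite Rplus_0_l (Rplus_comm h) => <-.
  by apply: RInt_ext => s _; rewrite /F p.
have c1 := RInt_Chasles F 0 h (2 * PI + h) (eF _ _) (eF _ _).
have c2 := RInt_Chasles F 0 (2 * PI) (2 * PI + h) (eF _ _) (eF _ _).
move: c1 c2; rewrite /plus /= e1; lra.
Qed.

(** The list splits at [j]: integrals inside [cint j] commute with the translation, [cint j] absorbs
    it by periodicity, and the outer ones then see the same function. *)
Lemma iint_translate l j h f : uniq l -> j \in l -> ctn f -> periodic_in j f ->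
  iint l (fun x => f (translate j h x)) = iint l f.
Proof.
move=> + + hf p; elim: l => //= i l IH /andP [il ul]; rewrite inE.
case: (j =P i) => [ji _|_ /= jl]; last by rewrite IH.
have jl : j \notin l by rewrite ji.
rewrite -ji.
rewrite (iint_translate_notin _ _ jl) cint_translate //; first exact: ctn_iint.
exact: periodic_in_iint.
Qed.

End IteratedIntegrals.
Arguments ctn_lin [N] a b [f g] _ _ _.

(** Two applications of the mean value theorem, hence [C] where the sharp constant would be C/2. *)
Lemma taylor2_bound (p dp ddp : R -> R) (C a h : R) :
  (forall t, is_derive p t (dp t)) -> (forall t, is_derive dp t (ddp t)) ->
  (forall t, Rabs (ddp t) <= C) ->
  Rabs (p (a + h) - p a - h * dp a) <= C * h ^ 2.
Proof.
move=> h1 h2 hC.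
have ct (q dq : R -> R) : (forall t, is_derive q t (dq t)) -> forall t, continuity_pt q t.
  move=> hq t; apply/continuity_pt_filterlim; apply: (ex_derive_continuous q).
  by eexists; exact: hq.
have [c [hc ->]] := MVT_gen p a (a + h) dp (fun t _ => h1 t) (fun t _ => ct _ _ h1 t).
have [e [_ E]] := MVT_gen dp a c ddp (fun t _ => h2 t) (fun t _ => ct _ _ h2 t).
have -> : dp c * (a + h - a) - h * dp a = ddp e * (c - a) * h by rewrite -E; ring.
rewrite !Rabs_mult Rmult_assoc.
apply: Rmult_le_compat => //; try exact: Rabs_pos.
  by apply: Rmult_le_pos; exact: Rabs_pos.
rewrite -(pow2_abs h) /= Rmult_1_r; apply: Rmult_le_compat_r; first exact: Rabs_pos.
move: hc; rewrite /Rmin /Rmax; case: Rle_dec => ? [? ?]; split_Rabs; lra.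
Qed.

(** * Periodic functions and the complex torus integral *)

Section Periodic.
Variable N : nat.
Implicit Types (x y : vec N) (l : seq 'I_N).

Lemma box_bounded (f : vec N -> R) : ctn f ->
  exists M, forall x, (forall i, 0 <= x i <= 2 * PI) -> Rabs (f x) <= M.
Proof.
move=> hf.
(* Induction on the coordinates [l] that already range over all of [0,2 PI], the others staying near
   [x]. One number serves as radius [d] and as bound [/ d], so that shrinking the radius by
   compactness automatically enlarges the bound. *)
have H : forall l x, exists d : posreal, forall y,
    (forall i, i \notin l -> Rabs (y i - x i) < d) ->
    (forall i, i \in l -> 0 <= y i <= 2 * PI) -> Rabs (f y) <= / d.
  elim => [x|j l IH x].
    have /filterlim_locally /(_ (mkposreal 1 Rlt_0_1)) [d hd] := hf x.
    have P : 0 < Rmin d (/ (Rabs (f x) + 1)).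
      apply: Rmin_glb_lt; first exact: cond_pos.
      by apply: Rinv_0_lt_compat; have := Rabs_pos (f x); lra.
    exists (mkposreal _ P) => y hy _ /=.
    have : ball x d y.
      by apply: ballP => i; apply: Rlt_le_trans (hy i _) _ => //; exact: Rmin_l.
    move=> /hd /= h3; have : Rabs (f y - f x) < 1 by [].
    move=> h4; apply: (Rle_trans _ (Rabs (f x) + 1)); first by split_Rabs; lra.
    rewrite -{1}(Rinv_inv (Rabs (f x) + 1)); apply: Rinv_le_contravar => //.
    exact: Rmin_r.
  have /lebesgue_number_1d [d hd] := fun t (_ : 0 <= t <= 2 * PI) => IH (upd x j t).
  exists d => y h1 h2.
  have [t [e [_ [Q [h3 h4]]]]] := hd _ (h2 j (mem_head _ _)).
  apply: Rle_trans (Q y _ _) _.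
  - move=> i il; rewrite /upd; case: (i =P j) => [->//|/eqP ij].
    by apply: Rlt_le_trans h4; apply: h1; rewrite inE negb_or ij.
  - by move=> i il; apply: h2; rewrite inE il orbT.
  - by apply: Rinv_le_contravar => //; exact: cond_pos.
have [d hd] := H (enum 'I_N) (fun _ => 0).
exists (/ d) => x hx; apply: hd => i; first by rewrite mem_enum.
by move=> _; exact: hx.
Qed.

Lemma to_box x : exists k : 'I_N -> Z, forall i, 0 <= x i + 2 * PI * IZR (k i) <= 2 * PI.
Proof.
exists (fun i => - Int_part (x i / (2 * PI)))%Z => i.
have P := twoPI_gt0.
have [h1 h2] := base_Int_part (x i / (2 * PI)); rewrite opp_IZR.
set m := IZR _ in h1 h2 *.
have E : x i = 2 * PI * (x i / (2 * PI)) by field; lra.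
set q := x i / _ in h1 h2 E; rewrite E; split; nra.
Qed.

Lemma periodic_slice (f : vec N -> C) j x s : periodic f ->
  f (upd x j (s + 2 * PI)) = f (upd x j s).
Proof.
move=> p; rewrite -(p (fun i => if i == j then 1%Z else 0%Z) (upd x j s)); congr f.
by apply: functional_extensionality => i; rewrite /upd; case: eqP => _ /=; ring.
Qed.

Definition cctn (f : vec N -> C) := forall x, continuous f x.

Lemma cctn_Re f : cctn f -> ctn (fun x => Re (f x)).
Proof. by move=> h x; apply: continuous_Re. Qed.

Lemma cctn_Im f : cctn f -> ctn (fun x => Im (f x)).
Proof. by move=> h x; apply: continuous_Im. Qed.

Lemma cctn_pair f : ctn (fun x => Re (f x)) -> ctn (fun x => Im (f x)) -> cctn f.
Proof. by move=> h1 h2 x; apply: continuous_ReIm. Qed.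

Lemma ctn_mult (f g : vec N -> R) : ctn f -> ctn g -> ctn (fun x => f x * g x).
Proof. by move=> hf hg x; apply: (continuous_mult f g). Qed.

Lemma ctn_ext (f g : vec N -> R) : (forall x, f x = g x) -> ctn f -> ctn g.
Proof. by move=> /functional_extensionality ->. Qed.

Lemma cctn_plus f g : cctn f -> cctn g -> cctn (fun x => f x + g x)%C.
Proof.
move=> hf hg; apply: cctn_pair.
  by apply: (ctn_ext _ (ctn_lin 1 1 (cctn_Re hf) (cctn_Re hg))) => x; rewrite !Rmult_1_l.
by apply: (ctn_ext _ (ctn_lin 1 1 (cctn_Im hf) (cctn_Im hg))) => x; rewrite !Rmult_1_l.
Qed.

Lemma cctn_mult f g : cctn f -> cctn g -> cctn (fun x => f x * g x)%C.
Proof.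
move=> hf hg.
have h1 := cctn_Re hf; have h2 := cctn_Im hf; have h3 := cctn_Re hg; have h4 := cctn_Im hg.
apply: cctn_pair.
  apply: (ctn_ext _ (ctn_lin 1 (-1) (ctn_mult h1 h3) (ctn_mult h2 h4))) => x /=.
  by rewrite /Re /Im; ring.
apply: (ctn_ext _ (ctn_lin 1 1 (ctn_mult h1 h4) (ctn_mult h2 h3))) => x /=.
by rewrite /Re /Im; ring.
Qed.

Lemma cctn_const c : cctn (fun _ => c).
Proof. by move=> x; exact: continuous_const. Qed.

Lemma cctn_conj f : cctn f -> cctn (fun x => Cconj (f x)).
Proof.
move=> hf; apply: cctn_pair; first exact: (cctn_Re hf).
by apply: (ctn_ext _ (ctn_lin (-1) 0 (cctn_Im hf) (cctn_Im hf))) => x /=; rewrite /Im; ring.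
Qed.

Lemma cctn_opp f : cctn f -> cctn (fun x => - f x)%C.
Proof.
move=> hf; apply: cctn_pair.
  by apply: (ctn_ext _ (ctn_lin (-1) 0 (cctn_Re hf) (cctn_Re hf))) => x /=; rewrite /Re; ring.
by apply: (ctn_ext _ (ctn_lin (-1) 0 (cctn_Im hf) (cctn_Im hf))) => x /=; rewrite /Im; ring.
Qed.

Lemma cctn_translate j h f : cctn f -> cctn (fun x => f (translate j h x)).
Proof.
move=> hf x; apply: (continuous_comp (fun x => translate j h x) f) => //.
apply/filterlim_locally => e; exists e => y hy i; rewrite /translate /upd.
case: eqP => // _; have := hy j; rewrite /ball /= /AbsRing_ball /abs /minus /plus /opp /=.
by have -> : y j + h + - (x j + h) = y j + - x j by ring.
Qed.

Lemma bounded_periodic f : cctn f -> periodic f -> exists M, forall x, Cmod (f x) <= M.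
Proof.
move=> cf pf.
have [M1 h1] := box_bounded (cctn_Re cf); have [M2 h2] := box_bounded (cctn_Im cf).
exists (sqrt 2 * Rmax M1 M2) => x; have [k hk] := to_box x.
rewrite -(pf k x); apply: Rle_trans (Cmod_2Rmax _) _.
apply: Rmult_le_compat_l; first exact: sqrt_pos.
by apply: Rmax_lub; [apply: Rle_trans (Rmax_l _ _); exact: h1|apply: Rle_trans (Rmax_r _ _); exact: h2].
Qed.

(** The fold of [torus_int] with its list of coordinates and its base point left free, so that
    inductions on coordinates can be stated. *)
Definition cfold l (f : vec N -> C) : vec N -> C :=
  foldr (fun (j : 'I_N) (g : vec N -> C) (x : vec N) =>
           RInt (V := C_R_CompleteNormedModule) (fun s => g (upd x j s)) 0 (2 * PI)) f l.

Lemma cfoldE l f : cctn f ->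
  cfold l f = fun x => (iint l (fun y => Re (f y)) x, iint l (fun y => Im (f y)) x).
Proof.
move=> hf; elim: l => [|j l /= ->]; apply: functional_extensionality => x.
  by rewrite /=; case: (f x).
apply: (@is_RInt_unique C_R_CompleteNormedModule).
apply: (@is_RInt_fct_extend_pair R_NormedModule R_NormedModule);
  apply: (@RInt_correct R_CompleteNormedModule); apply: ex_RInt_slice; apply: ctn_iint.
  exact: cctn_Re.
exact: cctn_Im.
Qed.

Lemma cfold_plus l f g : cctn f -> cctn g ->
  cfold l (fun x => f x + g x)%C = fun x => (cfold l f x + cfold l g x)%C.
Proof.
move=> hf hg; rewrite !cfoldE //; last exact: cctn_plus.
apply: functional_extensionality => x; rewrite /Cplus /=.
have e1 := iint_lin l 1 1 (cctn_Re hf) (cctn_Re hg).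
have e2 := iint_lin l 1 1 (cctn_Im hf) (cctn_Im hg).
congr pair.
  move: e1 => /(congr1 (fun F => F x)); rewrite !Rmult_1_l => <-.
  by congr iint; apply: functional_extensionality => y; rewrite /Re /=; ring.
move: e2 => /(congr1 (fun F => F x)); rewrite !Rmult_1_l => <-.
by congr iint; apply: functional_extensionality => y; rewrite /Im /=; ring.
Qed.

Lemma cfold_weight l w f : cctn w -> cctn f ->
  (forall j x s, j \in l -> w (upd x j s) = w x) ->
  cfold l (fun x => w x * f x)%C = fun x => (w x * cfold l f x)%C.
Proof.
move=> cw cf hw; rewrite !cfoldE //; last exact: cctn_mult.
have h1 := cctn_Re cf; have h2 := cctn_Im cf; have h3 := cctn_Re cw; have h4 := cctn_Im cw.
have hr j x s : j \in l -> Re (w (upd x j s)) = Re (w x) by move=> /hw ->.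
have hi j x s : j \in l -> Im (w (upd x j s)) = Im (w x) by move=> /hw ->.
apply: functional_extensionality => x; rewrite /Cmult /=; congr pair.
  have := iint_lin l 1 (-1) (ctn_mult h3 h1) (ctn_mult h4 h2).
  rewrite (iint_weight h1 hr) (iint_weight h2 hi) => /(congr1 (fun F => F x)) E.
  transitivity (iint l (fun x => 1 * (Re (w x) * Re (f x)) + -1 * (Im (w x) * Im (f x))) x); last by rewrite E /Re /Im; ring.
  by congr iint; apply: functional_extensionality => y; rewrite /Re /Im /=; ring.
have := iint_lin l 1 1 (ctn_mult h3 h2) (ctn_mult h4 h1).
rewrite (iint_weight h2 hr) (iint_weight h1 hi) => /(congr1 (fun F => F x)) E.
transitivity (iint l (fun x => 1 * (Re (w x) * Im (f x)) + 1 * (Im (w x) * Re (f x))) x); last by rewrite E /Re /Im; ring.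
by congr iint; apply: functional_extensionality => y; rewrite /Re /Im /=; ring.
Qed.

Lemma torus_intE f : torus_int f = cfold (enum 'I_N) f (fun _ => 0).
Proof. by []. Qed.

Lemma torus_int_plus f g : cctn f -> cctn g ->
  torus_int (fun x => f x + g x)%C = (torus_int f + torus_int g)%C.
Proof. by move=> hf hg; rewrite !torus_intE cfold_plus. Qed.

Lemma torus_int_scal c f : cctn f ->
  torus_int (fun x => c * f x)%C = (c * torus_int f)%C.
Proof. by move=> hf; rewrite !torus_intE (@cfold_weight _ (fun _ => c)) //; exact: cctn_const. Qed.

Lemma torus_int_conj f : cctn f ->
  torus_int (fun x => Cconj (f x)) = Cconj (torus_int f).
Proof.
move=> hf; rewrite !torus_intE !cfoldE //; last exact: cctn_conj.
rewrite /Cconj /=; congr pair.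
have := iint_lin (enum 'I_N) (-1) 0 (cctn_Im hf) (cctn_Im hf).
move=> /(congr1 (fun F => F (fun _ => 0))) E.
transitivity (iint (enum 'I_N) (fun x => -1 * Im (f x) + 0 * Im (f x)) (fun _ => 0)); last by rewrite E; ring.
by congr iint; apply: functional_extensionality => y; rewrite /Im /=; ring.
Qed.

Lemma torus_int_bound f M : cctn f -> (forall x, Cmod (f x) <= M) ->
  Cmod (torus_int f) <= sqrt 2 * (2 * PI) ^ N * M.
Proof.
move=> hf hM; rewrite torus_intE cfoldE //.
apply: Rle_trans (Cmod_2Rmax _) _; rewrite Rmult_assoc /=.
apply: Rmult_le_compat_l; first exact: sqrt_pos.
have -> : (2 * PI) ^ N = (2 * PI) ^ size (enum 'I_N) by rewrite size_enum_ord.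
apply: Rmax_lub; apply: iint_bound.
- exact: cctn_Re.
- by move=> x; apply: Rle_trans (re_le_Cmod _) _.
- exact: cctn_Im.
- by move=> x; apply: Rle_trans (hM x); apply: Rle_trans (Rmax_Cmod _); exact: Rmax_r.
Qed.

Lemma torus_int_const c : torus_int (fun _ : vec N => c) = (RtoC ((2 * PI) ^ N) * c)%C.
Proof.
rewrite torus_intE cfoldE; last exact: cctn_const.
rewrite !iint_const size_enum_ord /Cmult /RtoC /Re /Im /=.
by congr pair; ring.
Qed.

Lemma torus_int_translate f j h : cctn f -> periodic f ->
  torus_int (fun x => f (translate j h x)) = torus_int f.
Proof.
move=> hf pf; rewrite !torus_intE cfoldE; last exact: cctn_translate.
rewrite cfoldE //.
have E (p : C -> R) : ctn (fun x => p (f x)) ->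
   iint (enum 'I_N) (fun x => p (f (translate j h x))) = iint (enum 'I_N) (fun x => p (f x)).
  move=> hp; apply: (iint_translate h (enum_uniq _) _ hp); first by rewrite mem_enum.
  by move=> x s; rewrite periodic_slice.
by rewrite (E Re) ?(E Im) //; [exact: cctn_Im|exact: cctn_Re].
Qed.

End Periodic.

(** * Uniqueness of Fourier coefficients in one variable *)

Section Uniqueness1d.
Variable x : R.
Let p s := 1 + cos (s - x).

Lemma kernel_ge0 n s : 0 <= p s ^ n.
Proof. by apply: pow_le; rewrite /p; have := COS_bound (s - x); lra. Qed.

(** Bernoulli's inequality, valid since cos >= -1. The left side has integral 2 PI over a period,
    which bounds the mass of the kernel away from zero. *)
Lemma bernoulli_ge n s : 1 + INR n * cos (s - x) <= p s ^ n.
Proof.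
have := COS_bound (s - x); rewrite /p; set c := cos _ => hc.
elim: n => [|n IH]; first by rewrite /=; lra.
rewrite S_INR -tech_pow_Rmult; have := pos_INR n.
have := Rmult_le_compat_l (1 + c) _ _ ltac:(lra) IH; nra.
Qed.

Lemma kernel_derive n s :
  is_derive (fun s => sin (s - x) * p s ^ n.+1) s
    ((INR n + 2) * (cos (s - x) * p s ^ n.+1) - (INR n + 1) * p s ^ n.+1).
Proof.
rewrite /p; auto_derive => //.
have := sin2_cos2 (s - x); rewrite /Rsqr /= -/(INR n.+1) S_INR.
set c := cos _; set S := sin _ => E.
transitivity (c * ((1 + c) * (1 + c) ^ n) - (S * S) * ((INR n + 1) * (1 + c) ^ n)).
  by ring.
have -> : S * S = 1 - c * c by lra.
by ring.
Qed.

(** The integral of [kernel_derive] over a period vanishes, so the cosine moment is (n+1)/(n+2)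
    times the mass. This is the concentration of the kernel at [x], measured by 1 - cos. *)
Lemma kernel_moment n a : is_RInt (fun s => p s ^ n.+1) 0 (2 * PI) a ->
  is_RInt (fun s => p s ^ n.+1 * (1 - cos (s - x))) 0 (2 * PI) (a / (INR n + 2)).
Proof.
move=> h.
have n0 := pos_INR n.
have h1 : is_RInt (fun s => (INR n + 2) * (cos (s - x) * p s ^ n.+1) - (INR n + 1) * p s ^ n.+1)
   0 (2 * PI) (sin (2 * PI - x) * p (2 * PI) ^ n.+1 - sin (0 - x) * p 0 ^ n.+1).
  apply: (is_RInt_derive (fun s => sin (s - x) * p s ^ n.+1)) => t _; first exact: kernel_derive.
  by apply: (@ex_derive_continuous R_AbsRing); rewrite /p; auto_derive.
have E : sin (2 * PI - x) * p (2 * PI) ^ n.+1 - sin (0 - x) * p 0 ^ n.+1 = 0.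
  have e1 : cos (2 * PI - x) = cos (0 - x).
    by rewrite -(cos_period (0 - x) 1); congr cos; rewrite /=; ring.
  have e2 : sin (2 * PI - x) = sin (0 - x).
    by rewrite -(sin_period (0 - x) 1); congr sin; rewrite /=; ring.
  by rewrite /p e1 e2; ring.
rewrite E in h1.
have h2 := is_RInt_plus _ _ _ _ _ _ (is_RInt_scal _ _ _ (- / (INR n + 2)) _ h1)
             (is_RInt_scal _ _ _ (/ (INR n + 2)) _ h).
have -> : a / (INR n + 2) = plus (scal (- / (INR n + 2)) 0) (scal (/ (INR n + 2)) a).
  by rewrite /plus /scal /= /mult /=; field; lra.
apply: is_RInt_ext h2 => s _; rewrite /plus /scal /= /mult /=; field; lra.
Qed.

Variable h : R -> R.
Hypothesis ch : forall t, continuous h t.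

(** Multiplication by cos (s - x) shifts the frequency by one up or down and the phase by x the
    other way; allowing every phase [a] is what closes the induction. *)
Lemma kernel_orthogonal :
  (forall (m : Z) (a : R), is_RInt (fun s => cos (IZR m * s + a) * h s) 0 (2 * PI) 0) ->
  forall n (m : Z) (a : R), is_RInt (fun s => cos (IZR m * s + a) * (p s ^ n * h s)) 0 (2 * PI) 0.
Proof.
move=> H; elim => [|n IH] m a.
  by apply: is_RInt_ext (H m a) => s _ /=; ring.
have h1 := is_RInt_plus _ _ _ _ _ _ (IH m a)
   (is_RInt_scal _ _ _ (/ 2) _ (is_RInt_plus _ _ _ _ _ _ (IH (m + 1)%Z (a - x)) (IH (m - 1)%Z (a + x)))).
have E : plus 0 (scal (/ 2) (plus 0 0)) = 0 by rewrite /plus /scal /= /mult /=; ring.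
rewrite E in h1; apply: is_RInt_ext h1 => s _; rewrite /plus /scal /= /mult /=.
rewrite plus_IZR minus_IZR.
have -> : (IZR m + 1) * s + (a - x) = (IZR m * s + a) + (s - x) by ring.
have -> : (IZR m - 1) * s + (a + x) = (IZR m * s + a) - (s - x) by ring.
rewrite (cos_plus _ (s - x)) (cos_minus _ (s - x)) /p; field.
Qed.

(** Near [x] this is continuity; away from [x], 1 - cos (s - x) is at least 1 - cos c, so a large
    multiple of it dominates 2M. The form matches [kernel_moment]. *)
Lemma modulus_by_cos (e : R) : 0 < x < 2 * PI -> 0 < e ->
  exists K, 0 <= K /\ forall s, 0 <= s <= 2 * PI -> Rabs (h s - h x) <= e + K * (1 - cos (s - x)).
Proof.
move=> hx he; have P := twoPI_gt0.
have := @ch x => /filterlim_locally /(_ (mkposreal e he)) [d hd].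
have [M hM] : exists M, forall s, 0 <= s <= 2 * PI -> Rabs (h s) <= M.
  have [||t [ht _]] := continuity_ab_maj (fun s => Rabs (h s)) 0 (2 * PI); [lra| |].
    move=> c _; apply/continuity_pt_filterlim.
    by apply: (continuous_comp h Rabs); [exact: ch|exact: continuous_Rabs].
  by exists (Rabs (h t)).
(* The distances to both endpoints enter because 1 - cos also vanishes at distance 2 PI: they keep
   |s - x| below 2 PI - c. *)
have [c [c0 [c1 [c2 [c3 c4]]]]] : exists c, 0 < c /\ c <= d /\ c <= x /\ c <= 2 * PI - x /\ c <= PI.
  have := cond_pos d => d0.
  exists (Rmin d (Rmin x (2 * PI - x))).
  have a1 := Rmin_l d (Rmin x (2 * PI - x)); have a2 := Rmin_r d (Rmin x (2 * PI - x)).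
  have a3 := Rmin_l x (2 * PI - x); have a4 := Rmin_r x (2 * PI - x).
  split; last by repeat split; lra.
  by do 2! [apply: Rmin_glb_lt => //]; lra.
have cc : cos c < 1 by rewrite -cos_0; apply: cos_decreasing_1; lra.
have M0 : 0 <= M by apply: Rle_trans (Rabs_pos _) (hM 0 _); lra.
exists (2 * M / (1 - cos c)); split.
  by apply: Rmult_le_pos; [lra|apply: Rlt_le; apply: Rinv_0_lt_compat; lra].
move=> s hs.
have cb := COS_bound (s - x).
have K0 : 0 <= 2 * M / (1 - cos c).
  by apply: Rmult_le_pos; [lra|apply: Rlt_le; apply: Rinv_0_lt_compat; lra].
case: (Rlt_dec (Rabs (s - x)) c) => hc.
  have : Rabs (h s - h x) < e by apply: (hd s); exact: Rlt_le_trans c1.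
  have : 0 <= 2 * M / (1 - cos c) * (1 - cos (s - x)) by apply: Rmult_le_pos; lra.
  lra.
have ca : cos (s - x) <= cos c.
  have -> : cos (s - x) = cos (Rabs (s - x)).
    by rewrite /Rabs; case: Rcase_abs => // _; rewrite cos_neg.
  have u1 : c <= Rabs (s - x) by lra.
  have u2 : Rabs (s - x) <= 2 * PI - c by split_Rabs; lra.
  case: (Rle_dec (Rabs (s - x)) PI) => hp; first by apply: cos_decr_1; lra.
  have -> : cos (Rabs (s - x)) = cos (2 * PI - Rabs (s - x)).
    rewrite -(cos_neg (2 * PI - _)) -(cos_period (- _) 1); congr cos; rewrite /=; ring.
  by apply: cos_decr_1; lra.
have : 2 * M <= 2 * M / (1 - cos c) * (1 - cos (s - x)).
  have E : 2 * M = 2 * M / (1 - cos c) * (1 - cos c) by field; lra.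
  by rewrite {1}E; apply: Rmult_le_compat_l; lra.
have := hM s hs; have := hM x; move=> /(_ ltac:(lra)).
split_Rabs; lra.
Qed.

(** If h(x) were nonzero, integrating h(x) - h against the kernel of mass I would give |h(x)| I <=
    |h(x)| I / 2 + K I / (n+2), which fails once n is large. *)
Lemma fourier_unique_interior : 0 < x < 2 * PI ->
  (forall (m : Z) (a : R), is_RInt (fun s => cos (IZR m * s + a) * h s) 0 (2 * PI) 0) ->
  h x = 0.
Proof.
move=> hx H; have P := twoPI_gt0.
apply: NNPP => hx0.
have c0 : 0 < Rabs (h x) / 2 by have := Rabs_pos_lt _ hx0; lra.
have [K [K0 hK]] := modulus_by_cos hx c0.
have [n hn] : exists n : nat, K < INR n * (Rabs (h x) / 2).
  have [n hn] := nfloor_ex (K / (Rabs (h x) / 2)) (Rle_mult_inv_pos _ _ K0 c0).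
  exists n.+1; rewrite S_INR; move: hn => [_ /(Rmult_lt_compat_r _ _ _ c0)].
  by have -> : K / (Rabs (h x) / 2) * (Rabs (h x) / 2) = K by field; lra.
pose q s := p s ^ n.+1.
have cq t : continuous q t.
  by apply: (@ex_derive_continuous R_AbsRing); rewrite /q /p; auto_derive.
have eq : ex_RInt q 0 (2 * PI) by apply: (@ex_RInt_continuous R_CompleteNormedModule).
have [I hI] := eq.
have I0 : 0 < I.
  rewrite -(is_RInt_unique _ _ _ _ hI).
  have hb : is_RInt (fun s => 1 + INR n.+1 * cos (s - x)) 0 (2 * PI) (2 * PI).
    move: (INR n.+1) => k.
    have E : 2 * PI = minus (2 * PI + k * sin (2 * PI - x)) (0 + k * sin (0 - x)).
      have -> : sin (2 * PI - x) = sin (0 - x).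
        by rewrite -(sin_period (0 - x) 1); congr sin; rewrite /=; ring.
      by rewrite /minus /plus /opp /=; ring.
    rewrite {2}E; apply: (is_RInt_derive (fun s => s + k * sin (s - x))) => t _.
      by auto_derive => //; rewrite /Rminus; ring.
    by apply: (@ex_derive_continuous R_AbsRing); auto_derive.
  apply: (Rlt_le_trans _ (2 * PI)) => //.
  rewrite -{1}(is_RInt_unique _ _ _ _ hb); apply: (RInt_le (fun s => 1 + INR n.+1 * cos (s - x)) q); [lra|by eexists; exact: hb|by eexists; exact: hI|].
  move=> s _; exact: bernoulli_ge.
have h1 := kernel_moment hI.
have h2 : is_RInt (fun s => q s * (h x - h s)) 0 (2 * PI) (h x * I).
  have u := is_RInt_plus _ _ _ _ _ _ (is_RInt_scal _ _ _ (h x) _ hI)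
      (is_RInt_scal _ _ _ (-1) _ (kernel_orthogonal H n.+1 0 0)).
  have E : plus (scal (h x) I) (scal (-1) 0) = h x * I by rewrite /plus /scal /= /mult /=; ring.
  rewrite E in u; apply: is_RInt_ext u => s _; rewrite /plus /scal /= /mult /=.
  by rewrite Rmult_0_l Rplus_0_l cos_0 /q /=; ring.
have h3 : is_RInt (fun s => q s * (Rabs (h x) / 2 + K * (1 - cos (s - x)))) 0 (2 * PI)
            (Rabs (h x) / 2 * I + K * (I / (INR n + 2))).
  have u := is_RInt_plus _ _ _ _ _ _ (is_RInt_scal _ _ _ (Rabs (h x) / 2) _ hI)
      (is_RInt_scal _ _ _ K _ h1).
  apply: is_RInt_ext u => s _; rewrite /plus /scal /= /mult /=; rewrite /q /=; ring.
have : Rabs (h x * I) <= Rabs (h x) / 2 * I + K * (I / (INR n + 2)).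
  apply: (@norm_RInt_le R_NormedModule _ _ 0 (2 * PI) _ _ _ _ h2 h3); first lra.
  move=> s hs; rewrite /norm /= /abs /= Rabs_mult (Rabs_pos_eq (q s)); last exact: kernel_ge0.
  apply: Rmult_le_compat_l; first exact: kernel_ge0.
  rewrite Rabs_minus_sym; exact: hK.
rewrite Rabs_mult (Rabs_pos_eq I); last lra.
have n0 := pos_INR n.
have : K * (I / (INR n + 2)) < Rabs (h x) / 2 * I.
  have -> : K * (I / (INR n + 2)) = K / (INR n + 2) * I by field; lra.
  apply: Rmult_lt_compat_r => //.
  apply: (Rmult_lt_reg_r (INR n + 2)); first lra.
  have -> : K / (INR n + 2) * (INR n + 2) = K by field; lra.
  nra.
lra.
Qed.

End Uniqueness1d.

Lemma fourier_unique_1d (h : R -> R) : (forall t, continuous h t) ->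
  (forall (m : Z) (a : R), is_RInt (fun s => cos (IZR m * s + a) * h s) 0 (2 * PI) 0) ->
  forall s, 0 <= s <= 2 * PI -> h s = 0.
Proof.
move=> ch H s hs; have P := twoPI_gt0.
apply: NNPP => h0; have a0 := Rabs_pos_lt _ h0.
have := @ch s => /filterlim_locally /(_ (mkposreal _ a0)) [d hd].
have d0 := cond_pos d.
(* The endpoints are reached by continuity: a nonzero value at [s] would persist at a nearby
   interior point, found by moving towards the middle. *)
have [t [ht td]] : exists t, 0 < t < 2 * PI /\ Rabs (t - s) < d.
  case: (Rle_dec s PI) => sp.
    exists (s + Rmin (d / 2) (PI / 2)).
    have m1 := Rmin_l (d / 2) (PI / 2); have m2 := Rmin_r (d / 2) (PI / 2).
    have m3 : 0 < Rmin (d / 2) (PI / 2) by apply: Rmin_glb_lt; lra.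
    by split; [lra|split_Rabs; lra].
  exists (s - Rmin (d / 2) (PI / 2)).
  have m1 := Rmin_l (d / 2) (PI / 2); have m2 := Rmin_r (d / 2) (PI / 2).
  have m3 : 0 < Rmin (d / 2) (PI / 2) by apply: Rmin_glb_lt; lra.
  by split; [lra|split_Rabs; lra].
have : Rabs (h t - h s) < Rabs (h s) by exact: (hd t td).
rewrite (fourier_unique_interior ch ht H); split_Rabs; lra.
Qed.

(** * Exponentials *)

HB.instance Definition _ := Monoid.isComLaw.Build R 0 Rplus
  (fun x y z => esym (Rplus_assoc x y z)) Rplus_comm Rplus_0_l.

Definition cis (a : R) : C := (cos a, sin a).

Lemma cisD a b : cis (a + b) = (cis a * cis b)%C.
Proof. by rewrite /cis cos_plus sin_plus /Cmult /=; congr pair; ring. Qed.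

Lemma cis0 : cis 0 = RtoC 1.
Proof. by rewrite /cis cos_0 sin_0. Qed.

Lemma Cmod_cis a : Cmod (cis a) = 1.
Proof.
rewrite /Cmod /=; transitivity (sqrt 1); last exact: sqrt_1.
congr sqrt.
by have := sin2_cos2 a; rewrite /Rsqr; lra.
Qed.

Lemma cis_period (m : Z) : cis (2 * PI * IZR m) = RtoC 1.
Proof.
have P n : cis (2 * PI * INR n) = RtoC 1.
  by rewrite -cis0 /cis -(cos_period 0 n) -(sin_period 0 n); congr (cos _, sin _); ring.
case: (Z.le_ge_cases 0 m) => hm.
  by rewrite -(Z2Nat.id m hm) -INR_IZR_INZ P.
have -> : IZR m = - INR (Z.to_nat (- m)).
  by rewrite INR_IZR_INZ Z2Nat.id ?opp_IZR; [ring|lia].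
have := P (Z.to_nat (- m)); rewrite /cis => [[h1 h2]].
by rewrite Ropp_mult_distr_r_reverse cos_neg sin_neg h1 h2 Ropp_0.
Qed.

Ltac change_R := match goal with |- @eq _ ?a ?b => change (@eq R a b) end.

Lemma fourier_unique_1d_C (g : R -> C) :
  (forall t, continuous (fun s => Re (g s)) t) -> (forall t, continuous (fun s => Im (g s)) t) ->
  (forall m : Z, RInt (V := C_R_CompleteNormedModule) (fun s => cis (IZR m * s) * g s)%C 0 (2 * PI) = RtoC 0) ->
  forall s, 0 <= s <= 2 * PI -> g s = RtoC 0.
Proof.
move=> cr ci H.
have cc (k : R) t : continuous (fun s => cos (k * s)) t.
  by apply: (@ex_derive_continuous R_AbsRing); auto_derive.
have cs (k : R) t : continuous (fun s => sin (k * s)) t.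
  by apply: (@ex_derive_continuous R_AbsRing); auto_derive.
have AB m : is_RInt (fun s => cos (IZR m * s) * Re (g s) - sin (IZR m * s) * Im (g s)) 0 (2 * PI) 0 /\
            is_RInt (fun s => cos (IZR m * s) * Im (g s) + sin (IZR m * s) * Re (g s)) 0 (2 * PI) 0.
  pose a := RInt (fun s => cos (IZR m * s) * Re (g s) - sin (IZR m * s) * Im (g s)) 0 (2 * PI).
  pose b := RInt (fun s => cos (IZR m * s) * Im (g s) + sin (IZR m * s) * Re (g s)) 0 (2 * PI).
  have h1 : is_RInt (fun s => cos (IZR m * s) * Re (g s) - sin (IZR m * s) * Im (g s)) 0 (2 * PI) a.
    apply: (@RInt_correct R_CompleteNormedModule); apply: (@ex_RInt_continuous R_CompleteNormedModule) => t _.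
    by apply: (continuous_minus (fun s => cos _ * _) (fun s => sin _ * _)); apply: (continuous_mult (fun s => _ (_ * s)) (fun s => _ (g s))).
  have h2 : is_RInt (fun s => cos (IZR m * s) * Im (g s) + sin (IZR m * s) * Re (g s)) 0 (2 * PI) b.
    apply: (@RInt_correct R_CompleteNormedModule); apply: (@ex_RInt_continuous R_CompleteNormedModule) => t _.
    by apply: (continuous_plus (fun s => cos _ * _) (fun s => sin _ * _)); apply: (continuous_mult (fun s => _ (_ * s)) (fun s => _ (g s))).
  have h3 := is_RInt_fct_extend_pair (fun s => cis (IZR m * s) * g s)%C 0 (2 * PI) a b h1 h2.
  have := @is_RInt_unique C_R_CompleteNormedModule _ _ _ _ h3; rewrite H => [[e1 e2]].
  by split; [move: h1; rewrite -e1|move: h2; rewrite -e2].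
(* The real and imaginary parts of one coefficient mix Re g and Im g. Half sums and half differences
   over the frequencies m and -m separate them. *)
have neg (m : Z) s : cos (IZR (- m) * s) = cos (IZR m * s) /\ sin (IZR (- m) * s) = - sin (IZR m * s).
  by rewrite opp_IZR Ropp_mult_distr_l_reverse cos_neg sin_neg.
have comb (f1 f2 : R -> R) (u v : R) : is_RInt f1 0 (2 * PI) 0 -> is_RInt f2 0 (2 * PI) 0 ->
   is_RInt (fun s => u * f1 s + v * f2 s) 0 (2 * PI) 0.
  move=> h1 h2.
  have := is_RInt_plus _ _ _ _ _ _ (is_RInt_scal _ _ _ u _ h1) (is_RInt_scal _ _ _ v _ h2).
  by rewrite /plus /scal /= /mult /= !Rmult_0_r Rplus_0_r.
move=> s hs.
have z1 : Re (g s) = 0.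
  apply: (fourier_unique_1d cr) hs => m a.
  have h1 := comb _ _ (cos a / 2) (cos a / 2) (AB m).1 (AB (- m)%Z).1.
  have h2 := comb _ _ (- sin a / 2) (sin a / 2) (AB m).2 (AB (- m)%Z).2.
  apply: is_RInt_ext (comb _ _ 1 1 h1 h2) => t _; rewrite (neg m t).1 (neg m t).2 cos_plus; change_R; field.
have z2 : Im (g s) = 0.
  apply: (fourier_unique_1d ci) hs => m a.
  have h1 := comb _ _ (cos a / 2) (cos a / 2) (AB m).2 (AB (- m)%Z).2.
  have h2 := comb _ _ (sin a / 2) (- sin a / 2) (AB m).1 (AB (- m)%Z).1.
  apply: is_RInt_ext (comb _ _ 1 1 h1 h2) => t _; rewrite (neg m t).1 (neg m t).2 cos_plus; change_R; field.
by move: z1 z2; case: (g s) => a b /= -> ->.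
Qed.

Section Exponentials.
Variable N : nat.
Implicit Types (x y : vec N) (k l : 'I_N -> Z) (j : 'I_N).

Definition dot k x : R := \big[Rplus/0]_(j < N) (IZR (k j) * x j).

Lemma dot_upd k x j s : dot k (upd x j s) = dot k x + IZR (k j) * (s - x j).
Proof.
rewrite /dot (bigD1 j) //= [in RHS](bigD1 j) //= upd_same.
rewrite (eq_bigr (fun i => IZR (k i) * x i)) => [|i ij]; first by ring.
by rewrite /upd (negbTE ij).
Qed.

Definition addk k l : 'I_N -> Z := fun j => (k j + l j)%Z.
Definition oppk k : 'I_N -> Z := fun j => (- k j)%Z.

Lemma dot_addk k l x : dot (addk k l) x = dot k x + dot l x.
Proof. by rewrite /dot -big_split; apply: eq_bigr => j _; rewrite plus_IZR /=; ring. Qed.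

Lemma dot_oppk k x : dot (oppk k) x = - dot k x.
Proof.
rewrite /dot; apply: (big_ind2 (fun a b => a = - b)); first by rewrite Ropp_0.
  by move=> a b c d -> ->; rewrite Ropp_plus_distr.
by move=> j _; rewrite opp_IZR; ring.
Qed.

Lemma dot_single j (m : Z) x : dot (fun i => if i == j then m else 0%Z) x = IZR m * x j.
Proof.
rewrite /dot (bigD1 j) //= eqxx big1 ?Rplus_0_r // => i /negbTE ->.
by rewrite Rmult_0_l.
Qed.

Lemma dot_period k (z : 'I_N -> Z) x :
  exists m : Z, dot k (fun i => x i + 2 * PI * IZR (z i)) = dot k x + 2 * PI * IZR m.
Proof.
rewrite /dot; apply: (big_ind2 (fun a b => exists m : Z, a = b + 2 * PI * IZR m)).
- by exists 0%Z; ring.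
- by move=> a b c d [m ->] [m' ->]; exists (m + m')%Z; rewrite plus_IZR; ring.
- by move=> i _; exists (k i * z i)%Z; rewrite mult_IZR; ring.
Qed.

Definition expo k : vec N -> C := fun x => cis (dot k x).

Lemma expo_addk k l x : expo (addk k l) x = (expo k x * expo l x)%C.
Proof. by rewrite /expo dot_addk cisD. Qed.

Lemma expo_oppk k x : expo (oppk k) x = Cconj (expo k x).
Proof. by rewrite /expo dot_oppk /cis cos_neg sin_neg. Qed.

Lemma expo_translate k j h x : expo k (translate j h x) = (cis (IZR (k j) * h) * expo k x)%C.
Proof.
rewrite /expo /translate dot_upd -cisD; congr cis; ring.
Qed.

Lemma Cmod_expo k x : Cmod (expo k x) = 1.
Proof. exact: Cmod_cis. Qed.

Lemma expo_periodic k : periodic (expo k).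
Proof.
move=> z x; have [m E] := dot_period k z x.
by rewrite /expo E cisD cis_period; ring.
Qed.

Lemma ctn_dot k : ctn (dot k).
Proof.
move=> x; rewrite /dot.
have H (r : seq 'I_N) : continuous (fun y : vec N => \big[Rplus/0]_(j <- r) (IZR (k j) * y j)) x.
  elim: r => [|j r IH].
    by apply: (continuous_ext (fun _ => 0)) => [y|]; [rewrite big_nil|exact: continuous_const].
  apply: (continuous_ext (fun y => (IZR (k j) * y j) + \big[Rplus/0]_(i <- r) (IZR (k i) * y i))).
    by move=> y; rewrite big_cons.
  apply: (continuous_plus (fun y : vec N => IZR (k j) * y j)) => //.
  by apply: (continuous_scal_r (IZR (k j)) (fun y : vec N => y j)); exact: continuous_coord.
exact: H.
Qed.

Lemma cctn_expo k : cctn (expo k).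
Proof.
apply: cctn_pair => x.
  apply: (continuous_comp (dot k) cos); first exact: ctn_dot.
  by apply: (@ex_derive_continuous R_AbsRing); auto_derive.
apply: (continuous_comp (dot k) sin); first exact: ctn_dot.
by apply: (@ex_derive_continuous R_AbsRing); auto_derive.
Qed.

(** The Fourier multiplier of the iterated derivative along [s]. *)
Definition monom k (s : seq 'I_N) : C :=
  foldr (fun j c => (Ci * RtoC (IZR (k j)) * c)%C) (RtoC 1) s.

Lemma partial_expo k j (c : C) x :
  ex_partial j (fun x => c * expo k x)%C x /\
  partial j (fun x => c * expo k x)%C x = (Ci * RtoC (IZR (k j)) * c * expo k x)%C.
Proof.
pose th s := dot k x + IZR (k j) * (s - x j).
have h1 : is_derive (fun s => Re (c * expo k (upd x j s))%C) (x j)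
   (Re (Ci * RtoC (IZR (k j)) * c * expo k x)%C).
  apply: (is_derive_ext (fun s => c.1 * cos (th s) - c.2 * sin (th s))).
    by move=> s; rewrite /expo dot_upd.
  rewrite /th /expo /cis; auto_derive => //.
  have -> : dot k x + IZR (k j) * (x j + - x j) = dot k x by ring.
  by rewrite /=; ring.
have h2 : is_derive (fun s => Im (c * expo k (upd x j s))%C) (x j)
   (Im (Ci * RtoC (IZR (k j)) * c * expo k x)%C).
  apply: (is_derive_ext (fun s => c.1 * sin (th s) + c.2 * cos (th s))).
    by move=> s; rewrite /expo dot_upd.
  rewrite /th /expo /cis; auto_derive => //.
  have -> : dot k x + IZR (k j) * (x j + - x j) = dot k x by ring.
  by rewrite /=; ring.
split; first by split; eexists; [exact: h1|exact: h2].
by rewrite /partial (is_derive_unique _ _ _ h1) (is_derive_unique _ _ _ h2); case: (Cmult _ _).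
Qed.

Lemma partials_expo k s : partials s (expo k) = fun x => (monom k s * expo k x)%C.
Proof.
elim: s => [|j s /= ->]; apply: functional_extensionality => x.
  by rewrite /=; ring.
by rewrite (partial_expo k j _ x).2.
Qed.

Lemma smooth_expo k : smooth (expo k).
Proof.
move=> s x; rewrite partials_expo; split.
  by apply: cctn_mult; [exact: cctn_const|exact: cctn_expo].
by move=> j; exact: (partial_expo k j _ x).1.
Qed.

Definition expC k : Cinf N := mkCinf (smooth_expo k) (expo_periodic k).

Lemma partial_expC k j : Cinf_partial j (expC k) = scal (Ci * RtoC (IZR (k j)))%C (expC k).
Proof.
apply: Cinf_ext => x /=; change (partials [:: j] (expo k) x = (Ci * RtoC (IZR (k j)) * expo k x)%C).
by rewrite partials_expo /=; ring.
Qed.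

Lemma conj_expC k : Cinf_conj (expC k) = expC (oppk k).
Proof. by apply: Cinf_ext => x /=; rewrite expo_oppk. Qed.

End Exponentials.

(** * Fourier coefficients of smooth functions *)

Section FourierCoefficients.
Variable N : nat.
Implicit Types (x y : vec N) (k l : 'I_N -> Z) (j : 'I_N) (g : Cinf N).

Lemma cctn_Cinf g : cctn g.
Proof. by move=> x; have [] := cfun_smooth g [::] x. Qed.

Arguments cctn_Cinf g x : clear implicits.

Definition Cinf_partials (s : seq 'I_N) g : Cinf N := foldr (@Cinf_partial N) g s.

Lemma Cinf_partialsE s g x : Cinf_partials s g x = partials s g x.
Proof.
suff -> : partials s g = Cinf_partials s g by [].
by elim: s => //= j s ->.
Qed.

Lemma bounded_partials g s : exists M, forall x, Cmod (partials s g x) <= M.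
Proof.
have [M hM] := bounded_periodic (cctn_Cinf (Cinf_partials s g)) (cfun_periodic (Cinf_partials s g)).
by exists M => x; rewrite -Cinf_partialsE.
Qed.

Lemma ex_derive_slice g j x t :
  is_derive (fun s => Re (g (upd x j s))) t (Re (Cinf_partial j g (upd x j t))) /\
  is_derive (fun s => Im (g (upd x j s))) t (Im (Cinf_partial j g (upd x j t))).
Proof.
have [_ /(_ j) [h1 h2]] := cfun_smooth g [::] (upd x j t).
rewrite /= upd_same in h1 h2.
have E p : (fun s => p (g (upd (upd x j t) j s))) = (fun s => p (g (upd x j s))) :> (R -> R).
  by apply: functional_extensionality => s; rewrite upd_upd.
rewrite E in h1; rewrite E in h2.
by split; rewrite /= upd_same E; apply: Derive_correct.
Qed.

Lemma taylor2_Cinf g j M : (forall x, Cmod (Cinf_partial j (Cinf_partial j g) x) <= M) ->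
  forall x h, Cmod (g (translate j h x) - g x - RtoC h * Cinf_partial j g x)%C <= sqrt 2 * M * h ^ 2.
Proof.
set g2 := Cinf_partial j (Cinf_partial j g) => hM x h; rewrite /translate.
apply: Rle_trans (Cmod_2Rmax _) _; rewrite Rmult_assoc.
apply: Rmult_le_compat_l; first exact: sqrt_pos.
have b1 t : Rabs (Re (g2 (upd x j t))) <= M.
  by apply: Rle_trans (hM (upd x j t)); exact: re_le_Cmod.
have b2 t : Rabs (Im (g2 (upd x j t))) <= M.
  by apply: Rle_trans (hM (upd x j t)); apply: Rle_trans (Rmax_Cmod _); exact: Rmax_r.
have T1 := taylor2_bound (x j) h (fun t => (ex_derive_slice g j x t).1)
   (fun t => (ex_derive_slice (Cinf_partial j g) j x t).1) b1.
have T2 := taylor2_bound (x j) h (fun t => (ex_derive_slice g j x t).2)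
   (fun t => (ex_derive_slice (Cinf_partial j g) j x t).2) b2.
rewrite /= !upd_id in T1 T2.
apply: Rmax_lub.
  by move: T1; congr (Rabs _ <= _); rewrite /= /Re /Im /=; ring.
by move: T2; congr (Rabs _ <= _); rewrite /= /Re /Im /=; ring.
Qed.

Definition fcoef (f : vec N -> C) k : C := torus_int (fun x => f x * expo (oppk k) x)%C.

Lemma cctn_fcoef (f : vec N -> C) k : cctn f -> cctn (fun x => f x * expo (oppk k) x)%C.
Proof. by move=> hf; apply: cctn_mult => //; exact: cctn_expo. Qed.

Lemma fcoef_plus (f g : vec N -> C) k : cctn f -> cctn g ->
  fcoef (fun x => f x + g x)%C k = (fcoef f k + fcoef g k)%C.
Proof.
move=> hf hg; rewrite /fcoef -torus_int_plus; try exact: cctn_fcoef.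
by congr torus_int; apply: functional_extensionality => x; ring.
Qed.

Lemma fcoef_scal c (f : vec N -> C) k : cctn f ->
  fcoef (fun x => c * f x)%C k = (c * fcoef f k)%C.
Proof.
move=> hf; rewrite /fcoef -torus_int_scal; last exact: cctn_fcoef.
by congr torus_int; apply: functional_extensionality => x; ring.
Qed.

Lemma oppkK k : oppk (oppk k) = k.
Proof. by apply: functional_extensionality => j; rewrite /oppk Z.opp_involutive. Qed.

Lemma fcoef_conj (f : vec N -> C) k : cctn f ->
  fcoef (fun x => Cconj (f x)) k = Cconj (fcoef f (oppk k)).
Proof.
move=> hf; rewrite /fcoef -torus_int_conj; last exact: cctn_fcoef.
congr torus_int; apply: functional_extensionality => x.
by rewrite Cmult_conj oppkK expo_oppk.
Qed.

Lemma fcoef_bound (f : vec N -> C) k M : cctn f -> (forall x, Cmod (f x) <= M) ->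
  Cmod (fcoef f k) <= sqrt 2 * (2 * PI) ^ N * M.
Proof.
move=> hf hM; apply: torus_int_bound; first exact: cctn_fcoef.
by move=> x; rewrite Cmod_mult Cmod_expo Rmult_1_r.
Qed.

(** The whole integrand, exponential included and multiplied by the phase, is translated; the phase
    then cancels against the one produced by [expo]. *)
Lemma fcoef_translate (f : vec N -> C) j h k : cctn f -> periodic f ->
  fcoef (fun x => f (translate j h x)) k = (cis (IZR (k j) * h) * fcoef f k)%C.
Proof.
move=> hf pf; rewrite /fcoef -torus_int_scal; last exact: cctn_fcoef.
pose F x := (cis (IZR (k j) * h) * (f x * expo (oppk k) x))%C.
have hF : cctn F by apply: cctn_mult; [exact: cctn_const|exact: cctn_fcoef].
have pF : periodic F by move=> z x; rewrite /F pf expo_periodic.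
rewrite -[RHS](torus_int_translate j h hF pF); congr torus_int.
apply: functional_extensionality => x; rewrite /F expo_translate /oppk opp_IZR.
have E : (cis (IZR (k j) * h) * cis (- IZR (k j) * h))%C = RtoC 1.
  by rewrite -cisD -cis0; congr cis; ring.
transitivity (f (translate j h x) * expo (fun i => (- k i)%Z) x *
   (cis (IZR (k j) * h) * cis (- IZR (k j) * h)))%C; last by ring.
by rewrite E; ring.
Qed.

Lemma small_zero (z : C) (M : R) : (forall h, 0 < h -> Cmod (RtoC h * z)%C <= M * h ^ 2) -> z = RtoC 0.
Proof.
move=> H; apply: Cmod_eq_0; apply: NNPP => z0.
have zp : 0 < Cmod z by have := Cmod_ge_0 z; lra.
have h0 : 0 < Cmod z / (Rabs M + 1) by apply: Rdiv_lt_0_compat => //; have := Rabs_pos M; lra.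
have := H _ h0; rewrite Cmod_mult Cmod_R (Rabs_pos_eq _ (Rlt_le _ _ h0)).
set h := _ / _ in h0 *.
have E : Cmod z = h * (Rabs M + 1) by rewrite /h; field; have := Rabs_pos M; lra.
rewrite {1}E => L; have := Rle_abs M; have : 0 < h * h by nra.
nra.
Qed.

(* Translating in x_j multiplies the k-th coefficient by cis (k_j h); comparing
   first-order expansions in h replaces an integration by parts. *)
Lemma fcoef_partial g j k :
  fcoef (Cinf_partial j g) k = (Ci * RtoC (IZR (k j)) * fcoef g k)%C.
Proof.
have [M1' /taylor2_Cinf] := bounded_partials g [:: j; j]; set M1 := _ * M1' => h1.
have [M2' /taylor2_Cinf] := bounded_partials (expC k) [:: j; j]; set M2 := _ * M2' => h2.
set A := fcoef g k.
pose B := sqrt 2 * (2 * PI) ^ N.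
suff : (fcoef (Cinf_partial j g) k - Ci * RtoC (IZR (k j)) * A)%C = RtoC 0.
  move=> E; transitivity ((fcoef (Cinf_partial j g) k - Ci * RtoC (IZR (k j)) * A) + Ci * RtoC (IZR (k j)) * A)%C; first by ring.
  by rewrite E; ring.
apply: (@small_zero _ (M2 * Cmod A + B * M1)) => h h0.
pose rem x := (g (translate j h x) - g x - RtoC h * Cinf_partial j g x)%C.
have ct : cctn (fun x => g (translate j h x)).
  exact: (@cctn_translate _ j h g (cctn_Cinf g)).
have c1 : cctn (fun x => RtoC h * Cinf_partial j g x)%C.
  by apply: cctn_mult; [exact: cctn_const|exact: cctn_Cinf].
have e1 : (fun x => g (translate j h x)) = (fun x => (g x + RtoC h * Cinf_partial j g x) + rem x)%C.
  by apply: functional_extensionality => x; rewrite /rem; ring.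
have crem : cctn rem.
  apply: cctn_plus => //; first by apply: cctn_plus => //; apply: (cctn_opp (cctn_Cinf g)).
  exact: cctn_opp.
have := fcoef_translate j h k (cctn_Cinf g) (cfun_periodic g).
rewrite e1 fcoef_plus //; last by apply: cctn_plus => //; exact: cctn_Cinf.
rewrite fcoef_plus //; last exact: cctn_Cinf.
rewrite fcoef_scal -/A; last exact: cctn_Cinf.
move=> E.
(* Both terms on the right are second-order remainders, one of the exponential and one of [g], so
   [small_zero] applies. *)
have e2 : (RtoC h * (fcoef (Cinf_partial j g) k - Ci * RtoC (IZR (k j)) * A))%C =
   ((cis (IZR (k j) * h) - 1 - RtoC h * (Ci * RtoC (IZR (k j)))) * A - fcoef rem k)%C.
  transitivity ((A + RtoC h * fcoef (Cinf_partial j g) k + fcoef rem k) - A - fcoef rem k - RtoC h * (Ci * RtoC (IZR (k j)) * A))%C; first by ring.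
  by rewrite E; ring.
rewrite e2; apply: Rle_trans (Cmod_triangle _ _) _; rewrite Cmod_opp Cmod_mult Rmult_plus_distr_r.
apply: Rplus_le_compat.
  have -> : M2 * Cmod A * h ^ 2 = M2 * h ^ 2 * Cmod A by ring.
  apply: Rmult_le_compat_r; first exact: Cmod_ge_0.
  (* At the base point 0 the exponential equals 1, so the remainder of [expC k] there is exactly
     that of [cis]. *)
  have := h2 (fun _ => 0) h.
  rewrite partial_expC; change (Cmod (expo k (translate j h (fun _ => 0)) - expo k (fun _ => 0) - RtoC h * (Ci * RtoC (IZR (k j)) * expo k (fun _ => 0)))%C <= M2 * h ^ 2 -> Cmod (cis (IZR (k j) * h) - 1 - RtoC h * (Ci * RtoC (IZR (k j))))%C <= M2 * h ^ 2).
  rewrite expo_translate.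
  have -> : expo k (fun _ => 0) = RtoC 1.
    rewrite /expo -cis0; congr cis; rewrite /dot big1 // => i _; exact: Rmult_0_r.
  by rewrite !Cmult_1_r.
rewrite Rmult_assoc; apply: fcoef_bound => // x; exact: h1.
Qed.

(** Off the diagonal, the coefficient of d_j of the exponential is computed in two ways: by the
    eigenvalue i k_j and by the multiplier i l_j. Since k_j and l_j differ for some j, it
    vanishes. *)
Lemma fcoef_expo k l : fcoef (expo k) l = if [forall j, Z.eqb (k j) (l j)] then RtoC ((2 * PI) ^ N) else RtoC 0.
Proof.
case: forallP => [H|/forallP /forallPn [j /Z.eqb_spec hj]].
  have -> : k = l by apply: functional_extensionality => j; apply/Z.eqb_eq; exact: H.
  rewrite /fcoef -[RHS]Cmult_1_r -torus_int_const; congr torus_int.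
  apply: functional_extensionality => x; rewrite -expo_addk /expo -cis0; congr cis.
  by rewrite dot_addk dot_oppk Rplus_opp_r.
have := fcoef_partial (expC k) j l; rewrite partial_expC.
rewrite (@fcoef_scal _ (expo k)); last exact: cctn_expo.
change (fcoef (expC k) l) with (fcoef (expo k) l); set z := fcoef _ _ => E.
have [h1 h2] : Re z = 0 /\ Im z = 0.
  have hz : IZR (k j) - IZR (l j) <> 0 by move=> h; apply: hj; apply: eq_IZR; lra.
  move: E => [E1 E2]; rewrite /Re /Im.
  split; apply: (Rmult_eq_reg_l _ _ _ _ hz); lra.
by case: z h1 h2 {E} => a b /= -> ->.
Qed.

Lemma cfold_outside (s : seq 'I_N) (f : vec N -> C) x y :
  (forall i, i \notin s -> x i = y i) -> cfold s f x = cfold s f y.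
Proof.
elim: s x y => [|j s IH] x y h /=.
  by congr f; apply: functional_extensionality => i; exact: h.
apply: (@RInt_ext C_R_CompleteNormedModule) => t _; apply: IH => i hi; rewrite /upd.
by case: (i =P j) => // /eqP ij; apply: h; rewrite inE negb_or ij.
Qed.

(** The head [j] of the list is the outermost integral, so the hypothesis says that the inner
    integral, as a function of the j-th coordinate, has vanishing Fourier coefficients. Quantifying
    over every base point in the box lets the induction continue inward. *)
Lemma cfold_unique (s : seq 'I_N) (f : vec N -> C) : uniq s -> cctn f ->
  (forall k x, (forall i, 0 <= x i <= 2 * PI) -> cfold s (fun y => f y * expo k y)%C x = RtoC 0) ->
  forall x, (forall i, 0 <= x i <= 2 * PI) -> f x = RtoC 0.
Proof.
move=> + hf; elim: s => [_ H x hx|j s IH /= /andP [js us] H].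
  have := H (fun _ => 0%Z) x hx; rewrite /= /expo.
  have -> : dot (fun _ : 'I_N => 0%Z) x = 0 by rewrite /dot big1 // => i _; exact: Rmult_0_l.
  by rewrite cis0 Cmult_1_r.
apply: IH => // k x hx.
have cF : cctn (fun y => f y * expo k y)%C by apply: cctn_mult => //; exact: cctn_expo.
set F := fun y => _ in cF *.
rewrite -(upd_id x j).
apply: (@fourier_unique_1d_C (fun t => cfold s F (upd x j t))) (hx j).
- by rewrite cfoldE //; apply: ctn_slice; apply: ctn_iint; exact: cctn_Re.
- by rewrite cfoldE //; apply: ctn_slice; apply: ctn_iint; exact: cctn_Im.
(* The one-variable frequency [m] is added to [k] at position [j] only; its exponential does not
   depend on the coordinates in [s] and leaves the inner integral. *)
move=> m; have := H (addk (fun i => if i == j then m else 0%Z) k) x hx.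
have -> : (fun y => f y * expo (addk (fun i => if i == j then m else 0%Z) k) y)%C =
          (fun y => cis (IZR m * y j) * F y)%C.
  by apply: functional_extensionality => y; rewrite expo_addk {1}/expo dot_single /F; ring.
rewrite (@cfold_weight _ s (fun y => cis (IZR m * y j))) //.
- by move=> <-; apply: (@RInt_ext C_R_CompleteNormedModule) => t _; rewrite upd_same.
- apply: cctn_pair => y.
    apply: (continuous_comp (fun z : vec N => z j) (fun t => cos (IZR m * t))); first exact: continuous_coord.
    by apply: (@ex_derive_continuous R_AbsRing); auto_derive.
  apply: (continuous_comp (fun z : vec N => z j) (fun t => sin (IZR m * t))); first exact: continuous_coord.
  by apply: (@ex_derive_continuous R_AbsRing); auto_derive.
- move=> i y t hi; rewrite /upd.
  by case: eqP => // ij; move: js; rewrite ij hi.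
Qed.

Lemma fcoef_unique (f : vec N -> C) : cctn f -> periodic f ->
  (forall k, fcoef f k = RtoC 0) -> forall x, f x = RtoC 0.
Proof.
move=> hf pf H x; have [z hz] := to_box x.
rewrite -(pf z x); apply: (cfold_unique (enum_uniq _) hf) hz => k y _.
rewrite (@cfold_outside _ _ y (fun _ => 0)); last by move=> i; rewrite mem_enum => /negP [].
by have := H (oppk k); rewrite /fcoef oppkK.
Qed.

Lemma fcoef_inj (f g : Cinf N) : (forall k, fcoef f k = fcoef g k) -> f = g.
Proof.
move=> H; apply: Cinf_ext => x.
have cg : cctn (fun x => -(1) * g x)%C by apply: cctn_mult; [exact: cctn_const|exact: cctn_Cinf].
have E : (f x + -(1) * g x)%C = RtoC 0.
  apply: (@fcoef_unique (fun x => f x + -(1) * g x)%C).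
  - by apply: cctn_plus => //; exact: cctn_Cinf.
  - by move=> z y; rewrite !cfun_periodic.
  - move=> k; rewrite fcoef_plus //; last exact: cctn_Cinf.
    by rewrite fcoef_scal ?H; [ring|exact: cctn_Cinf].
transitivity ((f x + -(1) * g x) + g x)%C; first by ring.
by rewrite E; ring.
Qed.

End FourierCoefficients.

Arguments cctn_Cinf [N] g x.

(** * Completeness of the space of smooth functions *)

Lemma is_derive_quadratic (p : R -> R) (a d K : R) :
  (forall h, Rabs (p (a + h) - p a - h * d) <= K * h ^ 2) -> is_derive p a d.
Proof.
move=> H; apply/is_derive_Reals => e e0.
have K0 : 0 < Rabs K + 1 by have := Rabs_pos K; lra.
have d0 : 0 < e / (Rabs K + 1) by apply: Rdiv_lt_0_compat.
exists (mkposreal _ d0) => h h0 /= hd.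
have hp := Rabs_pos_lt _ h0.
have -> : (p (a + h) - p a) / h - d = (p (a + h) - p a - h * d) / h by field.
rewrite Rabs_div //; apply: (Rmult_lt_reg_r (Rabs h)) => //.
have -> : Rabs (p (a + h) - p a - h * d) / Rabs h * Rabs h = Rabs (p (a + h) - p a - h * d).
  by field; lra.
apply: Rle_lt_trans (H h) _; rewrite -(pow2_abs h) /= Rmult_1_r -Rmult_assoc.
apply: Rmult_lt_compat_r => //.
apply: (Rle_lt_trans _ (Rabs K * Rabs h)).
  by apply: Rmult_le_compat_r; [exact: Rabs_pos|exact: Rle_abs].
apply: (Rle_lt_trans _ ((Rabs K + 1) * Rabs h)); first by lra.
have -> : e = (Rabs K + 1) * (e / (Rabs K + 1)) by field; lra.
exact: Rmult_lt_compat_l.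
Qed.

Lemma rate_lt (C e : R) : 0 < e -> exists M : nat, C / (INR M + 1) < e.
Proof.
move=> e0.
have [n [_ hn]] := nfloor_ex (Rabs C / e) (Rle_mult_inv_pos _ _ (Rabs_pos C) e0).
exists n; have n0 := pos_INR n.
apply: (Rmult_lt_reg_r (INR n + 1)); first lra.
have -> : C / (INR n + 1) * (INR n + 1) = C by field; lra.
apply: Rle_lt_trans (Rle_abs C) _.
have -> : Rabs C = e * (Rabs C / e) by field; lra.
exact: Rmult_lt_compat_l.
Qed.

Lemma rate_le (C : R) (M M' : nat) : 0 <= C -> (M <= M')%N -> C / (INR M' + 1) <= C / (INR M + 1).
Proof.
move=> C0 /leP /le_INR h; have m0 := pos_INR M.
apply: Rmult_le_compat_l => //; apply: Rinv_le_contravar; lra.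
Qed.

(** The rate makes the sequence Cauchy, and letting M' tend to infinity in the hypothesis preserves
    the bound. *)
Lemma lim_rate (u : nat -> R) (C : R) :
  (forall M M', (M <= M')%N -> Rabs (u M' - u M) <= C / (INR M + 1)) ->
  forall M, Rabs (u M - real (Lim_seq u)) <= C / (INR M + 1).
Proof.
move=> H.
have C0 : 0 <= C.
  have := H 0%N 0%N (leqnn _); rewrite /= Rplus_0_l Rdiv_1_r.
  by apply: Rle_trans; exact: Rabs_pos.
have ex : ex_finite_lim_seq u.
  apply/ex_lim_seq_cauchy_corr => e.
  have [M hM] := rate_lt C (is_pos_div_2 e).
  exists M => n m /leP hn /leP hm.
  have h1 := H _ _ hn; have h2 := H _ _ hm.
  have -> : u n - u m = (u n - u M) - (u m - u M) by ring.
  apply: Rle_lt_trans (Rabs_triang _ _) _; rewrite Rabs_Ropp; move: hM => /=; lra.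
have [l hl] := ex; rewrite (is_lim_seq_unique _ _ hl) /= => M.
have h3 : is_lim_seq (fun m => Rabs (u M - u (m + M)%coq_nat)) (Rabs (u M - l)).
  apply: (is_lim_seq_abs _ (Rbar.Finite (u M - l))).
  apply: is_lim_seq_minus'; first exact: is_lim_seq_const.
  exact: (proj1 (is_lim_seq_incr_n u M _) hl).
apply: (is_lim_seq_le _ (fun _ => C / (INR M + 1)) _ (Rbar.Finite _) _ h3 (is_lim_seq_const _)) => m.
by rewrite Rabs_minus_sym; apply: H; apply/leP; lia.
Qed.

Section Completeness.
Variable N : nat.
Implicit Types (x : vec N) (s : seq 'I_N).
Variable fn : nat -> Cinf N.
Hypothesis cauchy : forall s, exists C, forall M M' x, (M <= M')%N ->
  Cmod (partials s (fn M') x - partials s (fn M) x)%C <= C / (INR M + 1).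

(** Limits are taken for all derivative words at once; only afterwards is each shown to be the
    derivative of the previous one. *)
Definition lim_partials s x : C :=
  (real (Lim_seq (fun M => Re (partials s (fn M) x))),
   real (Lim_seq (fun M => Im (partials s (fn M) x)))).

Lemma lim_partials_rate s : exists C, 0 <= C /\ forall M x,
  Cmod (partials s (fn M) x - lim_partials s x)%C <= C / (INR M + 1).
Proof.
have [C hC] := cauchy s; exists (sqrt 2 * C).
have C0 : 0 <= C.
  have := hC 0%N 0%N (fun _ => 0) (leqnn _); rewrite /= Rplus_0_l Rdiv_1_r.
  by apply: Rle_trans; exact: Cmod_ge_0.
split; first by apply: Rmult_le_pos => //; exact: sqrt_pos.
move=> M x; apply: Rle_trans (Cmod_2Rmax _) _.
have -> : sqrt 2 * C / (INR M + 1) = sqrt 2 * (C / (INR M + 1)) by rewrite /Rdiv; ring.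
apply: Rmult_le_compat_l; first exact: sqrt_pos.
apply: Rmax_lub.
  apply: (lim_rate (u := fun M => Re (partials s (fn M) x))) => {}M M' h.
  by apply: Rle_trans (hC _ _ x h); exact: (re_le_Cmod (_ - _)%C).
apply: (lim_rate (u := fun M => Im (partials s (fn M) x))) => {}M M' h.
by apply: Rle_trans (hC _ _ x h); apply: Rle_trans (Rmax_Cmod _); exact: Rmax_r.
Qed.

Lemma Cmod_limit_le (z : C) (C e : R) : (forall M : nat, Cmod z <= C / (INR M + 1) + e) -> Cmod z <= e.
Proof.
move=> H; apply: le_epsilon => d d0; have [M hM] := rate_lt C d0.
apply: Rle_trans (H M) _; lra.
Qed.

Lemma cctn_lim_partials s : cctn (lim_partials s).
Proof.
have [D [D0 hC]] := lim_partials_rate s.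
have cf M : cctn (partials s (fn M)).
  by move=> x; apply: (continuous_ext (Cinf_partials s (fn M))) => [y|]; [exact: Cinf_partialsE|exact: cctn_Cinf].
suff key (p : C -> R) : (forall z w, Rabs (p z - p w) <= Cmod (z - w)%C) ->
    (forall M, ctn (fun x => p (partials s (fn M) x))) -> ctn (fun x => p (lim_partials s x)).
  apply: cctn_pair.
    by apply: key => [z w|M]; [exact: (re_le_Cmod (_ - _)%C)|exact: cctn_Re].
  apply: key => [z w|M]; last exact: cctn_Im.
  by apply: Rle_trans (Rmax_Cmod (z - w)%C); exact: Rmax_r.
move=> hp hc x; apply/filterlim_locally => e.
have e3 : 0 < e / 3 by have := cond_pos e; lra.
have [M hM] := rate_lt D e3.
have := hc M x => /filterlim_locally /(_ (mkposreal _ e3)).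
apply: filter_imp => y hy.
change (Rabs (p (lim_partials s y) - p (lim_partials s x)) < e).
have h1 : Rabs (p (partials s (fn M) y) - p (partials s (fn M) x)) < e / 3 by [].
have h2 := Rle_trans _ _ _ (hp _ _) (hC M x).
have h3 := Rle_trans _ _ _ (hp _ _) (hC M y).
have -> : p (lim_partials s y) - p (lim_partials s x) =
   (p (partials s (fn M) y) - p (partials s (fn M) x)) + (p (partials s (fn M) x) - p (lim_partials s x))
   - (p (partials s (fn M) y) - p (lim_partials s y)) by ring.
apply: Rle_lt_trans (Rabs_triang _ _) _; rewrite Rabs_Ropp.
have := Rabs_triang (p (partials s (fn M) y) - p (partials s (fn M) x)) (p (partials s (fn M) x) - p (lim_partials s x)).
lra.
Qed.

(** The Taylor bound holds for [fn M] with a constant independent of [M], and replacing its three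
    terms by their limits costs a multiple of 1/(M+1) for fixed [h]. *)
Lemma lim_partials_taylor s j : exists K, forall x h,
  Cmod (lim_partials s (translate j h x) - lim_partials s x - RtoC h * lim_partials (j :: s) x)%C <= K * h ^ 2.
Proof.
have [C [C0 hC]] := lim_partials_rate s; have [C1 [C10 hC1]] := lim_partials_rate (j :: s).
have [C2 hC2] := cauchy [:: j, j & s].
have [B hB] := bounded_partials (fn 0) [:: j, j & s].
(* The second derivatives of all [fn M] are bounded by those of [fn 0] ([B]) plus their distance
   from them ([C2], the rate at index 0). *)
exists (sqrt 2 * (C2 + B)) => x h.
apply: (@Cmod_limit_le _ (C + C + Rabs h * C1)) => M.
have E : Cmod (partials s (fn M) (translate j h x) - partials s (fn M) x - RtoC h * partials (j :: s) (fn M) x)%C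
   <= sqrt 2 * (C2 + B) * h ^ 2.
  have T y : Cmod (Cinf_partials [:: j, j & s] (fn M) y) <= C2 + B.
    rewrite Cinf_partialsE.
    have := hC2 0%N M y (leq0n _); rewrite -[INR 0]/0 Rplus_0_l Rdiv_1_r => h1.
    have -> : partials [:: j, j & s] (fn M) y =
      ((partials [:: j, j & s] (fn M) y - partials [:: j, j & s] (fn 0) y) + partials [:: j, j & s] (fn 0) y)%C by ring.
    by apply: Rle_trans (Cmod_triangle _ _) _; apply: Rplus_le_compat => //; exact: hB.
  have := @taylor2_Cinf N (Cinf_partials s (fn M)) j _ T x h.
  by rewrite -[Cinf_partial j _]/(Cinf_partials (j :: s) (fn M)) !Cinf_partialsE.
set a := partials s (fn M) (translate j h x) in E.
set b := partials s (fn M) x in E; set c := partials (j :: s) (fn M) x in E.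
set a' := lim_partials s (translate j h x); set b' := lim_partials s x; set c' := lim_partials (j :: s) x.
have -> : (a' - b' - RtoC h * c')%C = ((a - b - RtoC h * c) + (- (a - a') + ((b - b') + RtoC h * (c - c'))))%C by ring.
apply: Rle_trans (Cmod_triangle _ _) _; rewrite Rplus_comm; apply: Rplus_le_compat => //.
apply: Rle_trans (Cmod_triangle _ _) _; rewrite Cmod_opp.
have -> : (C + C + Rabs h * C1) / (INR M + 1) = C / (INR M + 1) + (C / (INR M + 1) + Rabs h * (C1 / (INR M + 1))).
  by rewrite /Rdiv; ring.
apply: Rplus_le_compat; first exact: hC.
apply: Rle_trans (Cmod_triangle _ _) _; apply: Rplus_le_compat; first exact: hC.
rewrite Cmod_mult Cmod_R; apply: Rmult_le_compat_l; [exact: Rabs_pos|exact: hC1].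
Qed.

Lemma lim_partials_derive s j x :
  is_derive (fun t => Re (lim_partials s (upd x j t))) (x j) (Re (lim_partials (j :: s) x)) /\
  is_derive (fun t => Im (lim_partials s (upd x j t))) (x j) (Im (lim_partials (j :: s) x)).
Proof.
have [K hK] := lim_partials_taylor s j.
split; apply: (@is_derive_quadratic _ _ _ K) => h; rewrite upd_id; apply: Rle_trans (hK x h).
  apply: Rle_trans (re_le_Cmod _); apply: Req_le; congr Rabs.
  by rewrite /translate; move: (lim_partials _ _) (lim_partials _ _) (lim_partials _ _) => u v w; rewrite /Re /=; ring.
apply: Rle_trans (Rmax_Cmod _); apply: Rle_trans (Rmax_r _ _); apply: Req_le; congr Rabs.
by rewrite /translate; move: (lim_partials _ _) (lim_partials _ _) (lim_partials _ _) => u v w; rewrite /Im /=; ring.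
Qed.

Lemma partials_lim s : partials s (lim_partials [::]) = lim_partials s.
Proof.
elim: s => [//|j s /= ->]; apply: functional_extensionality => x.
have [h1 h2] := lim_partials_derive s j x.
by rewrite /partial (is_derive_unique _ _ _ h1) (is_derive_unique _ _ _ h2).
Qed.

Lemma Cinf_complete : exists g : Cinf N, forall s, exists C, 0 <= C /\ forall M x,
  Cmod (partials s (fn M) x - partials s g x)%C <= C / (INR M + 1).
Proof.
have sm : smooth (lim_partials [::]).
  move=> s x; rewrite partials_lim; split; first exact: cctn_lim_partials.
  by move=> j; have [h1 h2] := lim_partials_derive s j x; split; eexists; [exact: h1|exact: h2].
have pe : periodic (lim_partials [::]).
  by move=> z x; rewrite /lim_partials; congr (real _, real _); apply: Lim_seq_ext => M; rewrite /= cfun_periodic.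
by exists (mkCinf sm pe) => s; rewrite /= partials_lim; exact: lim_partials_rate.
Qed.

End Completeness.

(** * Fourier series *)

Section Enumeration.

(** Nonnegative integers get even codes, negative ones odd codes. The code 1 is never produced, as
    it would stand for -0, and decodes to 0 like the code 0. *)
Definition code_Z (z : Z) : nat := if (z <? 0)%Z then (Z.abs_nat z).*2.+1 else (Z.abs_nat z).*2.
Definition decode_Z (m : nat) : Z := if odd m then (- Z.of_nat m./2)%Z else Z.of_nat m./2.

Lemma code_ZK : cancel code_Z decode_Z.
Proof.
move=> z; rewrite /code_Z /decode_Z; case: Z.ltb_spec => h /=; rewrite odd_double /=.
  by rewrite uphalf_double Zabs2Nat.id_abs; lia.
by rewrite doubleK Zabs2Nat.id_abs; lia.
Qed.

Lemma code_Z_le z : (code_Z z <= (Z.abs_nat z).*2.+1)%N.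
Proof. by rewrite /code_Z; case: (_ <? _)%Z. Qed.

(* Cantor pairing keeps the code polynomially bounded in the entries, so that
   rapid decay in the frequency is rapid decay in its index. *)
Definition code_seq (s : seq Z) : nat := foldr (fun z m => Cantor.to_nat (code_Z z, m)) 0%N s.

Fixpoint decode_seq (n m : nat) : seq Z :=
  if n is n'.+1 then decode_Z (Cantor.of_nat m).1 :: decode_seq n' (Cantor.of_nat m).2 else [::].

Lemma code_seqK s : decode_seq (size s) (code_seq s) = s.
Proof.
elim: s => [//|z s IH].
change (decode_seq (size s).+1 (Cantor.to_nat (code_Z z, code_seq s)) = z :: s).
by cbn [decode_seq]; rewrite Cantor.cancel_of_to /= code_ZK IH.
Qed.

Lemma cantor_le a b : (Cantor.to_nat (a, b) + 2 <= (a + b + 2) ^ 2)%N.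
Proof.
have := Cantor.to_nat_spec a b; set t := Cantor.to_nat _ => h.
apply/leP; rewrite -!plusE /expn /= -!multE; nia.
Qed.

Lemma code_seq_le n : exists q : nat, (0 < q)%N /\ forall (s : seq Z) (K : nat), size s = n ->
  all (fun z => Z.abs_nat z <= K)%N s -> (code_seq s + 2 <= (K + 2) ^ q)%N.
Proof.
elim: n => [|n [q [q0 IH]]].
  by exists 1%N; split => // -[|//] K _ _; rewrite expn1 /= leq_add2r.
(* The doubling is the square in [cantor_le]; the extra 2 absorbs the factor 4 <= (K+2)^2 in the
   bound of the sum of the two paired codes. *)
exists ((q + 2) * 2)%N; split; first by rewrite muln_gt0 addn_gt0 q0.
move=> [//|z s] K [hs] /= /andP [hz hK]; apply: leq_trans (cantor_le _ _) _; rewrite expnM leq_exp2r //.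
have h1 : (code_seq s + 2 <= (K + 2) ^ q)%N.
  exact: IH.
have h2 : (code_Z z <= K.*2.+1)%N.
  by apply: leq_trans (code_Z_le z) _; rewrite ltnS leq_double.
have h3 : (K + 2 <= (K + 2) ^ q)%N by rewrite -{1}(expn1 (K + 2)) leq_exp2l ?addn2.
rewrite expnD; set Y := (_ ^ q)%N in h1 h3 *.
apply: (@leq_trans (Y * 4)%N); last by rewrite leq_mul2l -[4%N]/(2 ^ 2)%N leq_exp2r // leq_addl orbT.
move: h1 h2 h3 => /leP h1 /leP h2 /leP h3; apply/leP.
move: h1 h2 h3; rewrite -!addnn -!multE -!plusE; lia.
Qed.

End Enumeration.

HB.instance Definition _ (G : AbelianMonoid) := Monoid.isComLaw.Build G zero plus
  (@plus_assoc G) (@plus_comm G) (fun u => eq_trans (plus_comm zero u) (plus_zero_r u)).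

Section Synthesis.
Variable N : nat.
Implicit Types (x : vec N) (k l : 'I_N -> Z) (s : seq 'I_N).

Definition idx k : nat := code_seq [seq k j | j <- enum 'I_N].
Definition kvec (m : nat) : 'I_N -> Z := fun j => nth 0%Z (decode_seq N m) j.

Lemma kvecK k : kvec (idx k) = k.
Proof.
apply: functional_extensionality => j; rewrite /kvec /idx.
have := code_seqK [seq k j | j <- enum 'I_N]; rewrite size_map size_enum_ord => ->.
by rewrite (nth_map j) ?size_enum_ord // nth_ord_enum.
Qed.

Definition knorm k : nat := \max_(j < N) Z.abs_nat (k j).

Lemma knorm_ge k j : (Z.abs_nat (k j) <= knorm k)%N.
Proof. exact: (leq_bigmax (F := fun j => Z.abs_nat (k j))). Qed.

Lemma knorm_oppk k : knorm (oppk k) = knorm k.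
Proof. by apply: eq_bigr => j _; rewrite /oppk; lia. Qed.

Lemma knorm_attained k : (0 < knorm k)%N -> exists j, Z.abs_nat (k j) = knorm k.
Proof.
move=> h; have N0 : (0 < #|'I_N|)%N.
  case: (pickP (fun _ : 'I_N => true)) => [j _|E]; first by apply/card_gt0P; exists j.
  by move: h; rewrite /knorm big_pred0.
by have [j hj] := eq_bigmax (fun j => Z.abs_nat (k j)) N0; exists j.
Qed.

Lemma idx_le : exists q : nat, forall k, (idx k + 2 <= (knorm k + 2) ^ q)%N.
Proof.
have [q [_ hq]] := code_seq_le N; exists q => k; apply: hq; first by rewrite size_map size_enum_ord.
by rewrite all_map; apply/allP => j _; exact: knorm_ge.
Qed.

Lemma Rabs_IZR_abs_nat (z : Z) : Rabs (IZR z) = INR (Z.abs_nat z).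
Proof. by rewrite -abs_IZR INR_IZR_INZ Zabs2Nat.id_abs. Qed.

Lemma Cmod_Ci : Cmod Ci = 1.
Proof. by rewrite /Ci /Cmod /= Rmult_0_l Rplus_0_l !Rmult_1_l sqrt_1. Qed.

Lemma Cmod_monom k s : Cmod (monom k s) <= (INR (knorm k) + 2) ^ size s.
Proof.
have n0 := pos_INR (knorm k).
elim: s => [|j s IH] /=; first by rewrite Cmod_1; lra.
rewrite !Cmod_mult Cmod_Ci Rmult_1_l Cmod_R.
apply: Rmult_le_compat => //; try exact: Rabs_pos; try exact: Cmod_ge_0.
rewrite Rabs_IZR_abs_nat; have := le_INR _ _ (leP (knorm_ge k j)); lra.
Qed.

(** The shift by 2 is the one in [idx_le] and keeps the weight positive at frequency 0. *)
Definition rapid (c : ('I_N -> Z) -> C) : Prop :=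
  forall p : nat, exists K : R, forall k, (INR (knorm k) + 2) ^ p * Cmod (c k) <= K.

Lemma finite_bound (F : 'I_N -> R -> Prop) :
  (forall j a b, a <= b -> F j a -> F j b) -> (forall j, exists a, F j a) ->
  exists a, forall j, F j a.
Proof.
move=> mono ex.
suff [a ha] : exists a, forall j, j \in enum 'I_N -> F j a.
  by exists a => j; apply: ha; rewrite mem_enum.
elim: (enum 'I_N) => [|i r [a IH]]; first by exists 0.
have [b hb] := ex i; exists (Rmax a b) => j; rewrite inE => /orP [/eqP ->|/IH h].
  by apply: mono hb; exact: Rmax_r.
by apply: mono h; exact: Rmax_l.
Qed.

Lemma fcoef_partials (g : Cinf N) j p k :
  fcoef (Cinf_partials (nseq p j) g) k = ((Ci * RtoC (IZR (k j))) ^ p * fcoef g k)%C.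
Proof.
elim: p => [|p IH] /=; first by ring.
by rewrite fcoef_partial IH; ring.
Qed.

(** The p-th derivative in the coordinate realising [knorm k] multiplies the coefficient by the p-th
    power of that norm while staying bounded. *)
Lemma rapid_fcoef (g : Cinf N) : rapid (fcoef g).
Proof.
move=> p.
have bd j q : exists a, forall k, INR (Z.abs_nat (k j)) ^ q * Cmod (fcoef g k) <= a.
  have [M hM] := bounded_partials g (nseq q j).
  exists (sqrt 2 * (2 * PI) ^ N * M) => k.
  have := @fcoef_bound N (Cinf_partials (nseq q j) g) k M (cctn_Cinf _).
  rewrite fcoef_partials Cmod_mult Cmod_pow Cmod_mult Cmod_Ci Rmult_1_l Cmod_R Rabs_IZR_abs_nat.
  by apply=> x; rewrite Cinf_partialsE.
have [a ha] : exists a, forall j k, INR (Z.abs_nat (k j)) ^ p * Cmod (fcoef g k) <= a.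
  apply: finite_bound => // j a b ab h k; exact: Rle_trans (h k) ab.
have [M hM] := bounded_partials g [::].
have hb k : Cmod (fcoef g k) <= sqrt 2 * (2 * PI) ^ N * M by apply: fcoef_bound => //; exact: cctn_Cinf.
set B := _ * M in hb.
(* For a nonzero frequency knorm + 2 <= 3 knorm, whence 3^p with the bound [a]; frequency 0 is
   covered by [B]. *)
exists (3 ^ p * (B + Rabs a)) => k.
have n0 := pos_INR (knorm k).
have m0 := Cmod_ge_0 (fcoef g k).
have B0 : 0 <= B by have := hb k; lra.
have a0 := Rabs_pos a; have a1 := Rle_abs a.
have p0 : 0 <= 3 ^ p by apply: pow_le; lra.
case: (leqP (knorm k) 0) => h.
  have -> : knorm k = 0%N by apply/eqP; rewrite -leqn0.
  apply: Rmult_le_compat => //; first by apply: pow_le; rewrite /=; lra.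
    by apply: pow_incr; rewrite /=; lra.
  by apply: Rle_trans (hb k) _; lra.
have [j hj] := knorm_attained h.
have h1 : 1 <= INR (knorm k) by rewrite -[1]/(INR 1); apply: le_INR; apply/leP.
apply: (Rle_trans _ (3 ^ p * (INR (knorm k) ^ p * Cmod (fcoef g k)))).
  rewrite -Rmult_assoc -Rpow_mult_distr; apply: Rmult_le_compat_r => //.
  by apply: pow_incr; lra.
by apply: Rmult_le_compat_l => //; have := ha j k; rewrite hj; lra.
Qed.

(* [kvec] is not injective, so only the index [idx k] is given the coefficient
   of [k]. *)
Definition mterm (c : ('I_N -> Z) -> C) (m : nat) : C :=
  if idx (kvec m) == m then c (kvec m) else RtoC 0.

Definition psum (c : ('I_N -> Z) -> C) (M : nat) : Cinf N :=
  \big[plus/zero]_(m < M) scal (mterm c m : C_Ring) (expC (kvec m) : Cinf_ModuleSpace N).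

Lemma psumS c M : psum c M.+1 = plus (psum c M) (scal (mterm c M : C_Ring) (expC (kvec M) : Cinf_ModuleSpace N)).
Proof. exact: big_ord_recr. Qed.

Lemma partials_psumS c M s x :
  partials s (psum c M.+1) x = (partials s (psum c M) x + mterm c M * (monom (kvec M) s * expo (kvec M) x))%C.
Proof.
rewrite psumS.
have := @partials_rlin N 1 0 1 0 0 1 0 1 (psum c M) (Cinf_scal (mterm c M) (expC (kvec M))) s (cfun_smooth _) (cfun_smooth _).
rewrite -!plus_rlin => /= ->; congr Cplus.
have := @partials_rlin N (Re (mterm c M)) (- Im (mterm c M)) 0 0 (Im (mterm c M)) (Re (mterm c M)) 0 0
  (expC (kvec M)) (expC (kvec M)) s (cfun_smooth _) (cfun_smooth _).
by rewrite -!scal_rlin /= partials_expo => ->.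
Qed.

(** The decay exponent [q * 2 + size s] pays for two things: [size s] for the multiplier of the
    derivative, and [q * 2] for the factor (m+1)(m+2), through [idx_le]. The terms are then
    dominated by a telescoping sequence. *)
Lemma psum_cauchy c : rapid c -> forall s, exists K, forall M M' x, (M <= M')%N ->
  Cmod (partials s (psum c M') x - partials s (psum c M) x)%C <= K / (INR M + 1).
Proof.
move=> hc s; have [q hq] := idx_le; have [K hK] := hc (q * 2 + size s)%N.
have K0 : 0 <= K.
  apply: Rle_trans (hK (fun _ => 0%Z)); apply: Rmult_le_pos (Cmod_ge_0 _).
  by apply: pow_le; have := pos_INR (knorm (fun _ : 'I_N => 0%Z)); lra.
have tele m x : Cmod (mterm c m * (monom (kvec m) s * expo (kvec m) x))%C <= K / (INR m + 1) - K / (INR m.+1 + 1).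
  have m0 := pos_INR m.
  have -> : K / (INR m + 1) - K / (INR m.+1 + 1) = K / ((INR m + 1) * (INR m + 2)).
    by rewrite S_INR; field; lra.
  have P : 0 < (INR m + 1) * (INR m + 2) by nra.
  rewrite /mterm; case: eqP => hm; last first.
    rewrite Cmult_0_l Cmod_0; apply: Rmult_le_pos => //; apply: Rlt_le; exact: Rinv_0_lt_compat.
  rewrite !Cmod_mult Cmod_expo Rmult_1_r.
  apply: (Rmult_le_reg_r ((INR m + 1) * (INR m + 2))) => //.
  have -> : K / ((INR m + 1) * (INR m + 2)) * ((INR m + 1) * (INR m + 2)) = K by field; lra.
  apply: Rle_trans (hK (kvec m)).
  have n0 := pos_INR (knorm (kvec m)).
  rewrite pow_add.
  set c0 := Cmod _; have c00 : 0 <= c0 by exact: Cmod_ge_0.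
  have h1 := Cmod_monom (kvec m) s.
  have h2 : (INR m + 1) * (INR m + 2) <= (INR (knorm (kvec m)) + 2) ^ (q * 2).
    have := hq (kvec m); rewrite hm => /leP /le_INR.
    have -> : INR ((knorm (kvec m) + 2) ^ q)%N = (INR (knorm (kvec m)) + 2) ^ q.
      have -> : INR (knorm (kvec m)) + 2 = INR (knorm (kvec m) + 2)%N by rewrite plus_INR.
      elim: (q) => [|r IH] //; rewrite expnS mult_INR IH //.
    rewrite plus_INR /= => h.
    have -> : (q * 2)%N = (q + q)%N by rewrite muln2 addnn.
    by rewrite pow_add; apply: Rmult_le_compat; lra.
  set X := (_ + 2) ^ (q * 2) in h2 *; set Y := (_ + 2) ^ size s in h1 *.
  have Y0 := Cmod_ge_0 (monom (kvec m) s).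
  have h3 : Cmod (monom (kvec m) s) * ((INR m + 1) * (INR m + 2)) <= Y * X.
    by apply: Rmult_le_compat => //; lra.
  have := Rmult_le_compat_l _ _ _ c00 h3; lra.
exists K => M M' x /subnKC <-.
apply: (Rle_trans _ (K / (INR M + 1) - K / (INR (M + (M' - M)) + 1))); last first.
  have := pos_INR (M + (M' - M)) => h.
  have : 0 <= K / (INR (M + (M' - M)) + 1).
    by apply: Rmult_le_pos => //; apply: Rlt_le; apply: Rinv_0_lt_compat; lra.
  lra.
elim: (M' - M)%N => [|d IH].
  rewrite addn0 !Rminus_diag.
  have -> : (partials s (psum c M) x - partials s (psum c M) x)%C = RtoC 0 by ring.
  by rewrite Cmod_0; lra.
rewrite addnS partials_psumS.
set a := partials s (psum c (M + d)) x in IH *; set b := partials s (psum c M) x in IH *.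
have := tele (M + d)%N x; set w := (mterm c (M + d) * _)%C => hw.
have -> : (a + w - b)%C = ((a - b) + w)%C by ring.
apply: Rle_trans (Cmod_triangle _ _) _; lra.
Qed.

Definition approx (f : nat -> Cinf N) (g : Cinf N) : Prop :=
  forall s, exists K, 0 <= K /\ forall M x,
  Cmod (partials s (f M) x - partials s g x)%C <= K / (INR M + 1).

Lemma synthesis c : rapid c -> exists g, approx (psum c) g.
Proof. by move=> /psum_cauchy /Cinf_complete. Qed.

Lemma eqk_idx k l : [forall j, Z.eqb (k j) (l j)] = (idx k == idx l).
Proof.
apply/forallP/eqP => [h|h j].
  by congr idx; apply: functional_extensionality => j; apply/Z.eqb_eq; exact: h.
by apply/Z.eqb_eq; rewrite -(kvecK k) h kvecK.
Qed.

Lemma fcoef_psum c M l :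
  fcoef (psum c M) l = if (idx l < M)%N then (RtoC ((2 * PI) ^ N) * c l)%C else RtoC 0.
Proof.
elim: M => [|M IH].
  rewrite /psum big_ord0 /= /fcoef; have := @torus_int_scal N (RtoC 0) (fun _ => RtoC 0) (@cctn_const N (RtoC 0)).
  rewrite [RHS]Cmult_0_l => E; rewrite -[RHS]E; congr torus_int; apply: functional_extensionality => x.
  by rewrite !Cmult_0_l.
rewrite psumS.
rewrite (@fcoef_plus _ (psum c M) (fun x => mterm c M * expC (kvec M) x)%C); last first.
- by apply: cctn_mult; [exact: cctn_const|exact: cctn_Cinf].
- exact: cctn_Cinf.
rewrite IH (@fcoef_scal _ _ (expC (kvec M))); last exact: cctn_Cinf.
rewrite (fcoef_expo (kvec M)) eqk_idx ltnS /mterm.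
case: (ltngtP (idx l) M) => h.
- case: eqP => [e1|_]; last by ring.
  by case: eqP => [e2|_]; [move: h; rewrite -e2 e1 ltnn|ring].
- case: eqP => [e1|_]; last by ring.
  by case: eqP => [e2|_]; [move: h; rewrite -e2 e1 ltnn|ring].
- by rewrite -h kvecK eqxx; ring.
Qed.

Lemma torus_int_approx (f : nat -> Cinf N) (g : Cinf N) (w : vec N -> C) : approx f g ->
  cctn w -> (exists B, forall x, Cmod (w x) <= B) ->
  exists K, forall M, Cmod (torus_int (fun x => f M x * w x)%C - torus_int (fun x => g x * w x)%C)%C <= K / (INR M + 1).
Proof.
move=> /(_ [::]) [K [K0 hK]] cw [B hB].
exists (sqrt 2 * (2 * PI) ^ N * (K * B)) => M.
pose d x := ((f M x - g x) * w x)%C.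
have c1 : cctn (fun x => f M x * w x)%C by apply: cctn_mult => //; exact: cctn_Cinf.
have c2 : cctn (fun x => g x * w x)%C by apply: cctn_mult => //; exact: cctn_Cinf.
have cd : cctn d.
  by apply: cctn_mult => //; apply: cctn_plus; [exact: cctn_Cinf|exact: (cctn_opp (cctn_Cinf g))].
have e : (fun x => f M x * w x)%C = (fun x => g x * w x + d x)%C.
  by apply: functional_extensionality => x; rewrite /d; ring.
rewrite e torus_int_plus //.
have -> : (torus_int (fun x => g x * w x) + torus_int d - torus_int (fun x => g x * w x))%C = torus_int d by ring.
have -> : sqrt 2 * (2 * PI) ^ N * (K * B) / (INR M + 1) = sqrt 2 * (2 * PI) ^ N * (K / (INR M + 1) * B).
  by rewrite /Rdiv; ring.
apply: torus_int_bound => // x; rewrite /d Cmod_mult.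
by apply: Rmult_le_compat => //; [exact: Cmod_ge_0|exact: Cmod_ge_0|exact: hK].
Qed.

Lemma rate_unique (z w : C) (u : nat -> C) (K : R) (M0 : nat) :
  (forall M, Cmod (u M - z)%C <= K / (INR M + 1)) -> (forall M, (M0 <= M)%N -> u M = w) -> w = z.
Proof.
move=> h hw.
have K0 : 0 <= K.
  have := h 0%N; rewrite /= Rplus_0_l Rdiv_1_r; apply: Rle_trans; exact: Cmod_ge_0.
have E : (w - z)%C = RtoC 0.
  apply: Cmod_eq_0; apply: Rle_antisym; last exact: Cmod_ge_0.
  apply: le_epsilon => e e0; have [M hM] := rate_lt K e0.
  rewrite Rplus_0_l -(hw (maxn M0 M)) ?leq_maxl //.
  apply: Rle_trans (h _) _; apply: Rle_trans (Rlt_le _ _ hM).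
  by apply: rate_le => //; exact: leq_maxr.
transitivity ((w - z) + z)%C; first by ring.
by rewrite E; ring.
Qed.

Lemma fcoef_approx c g : approx (psum c) g -> forall k, fcoef g k = (RtoC ((2 * PI) ^ N) * c k)%C.
Proof.
move=> h k; symmetry.
have [|K hK] := torus_int_approx h (@cctn_expo N (oppk k)).
  by exists 1 => x; rewrite Cmod_expo; lra.
apply: (rate_unique (M0 := (idx k).+1) hK) => M hM.
by rewrite -[LHS]/(fcoef (psum c M) k) fcoef_psum hM.
Qed.

(** The series converges to some smooth function with the coefficients of [g], and injectivity of
    the coefficients identifies it with [g]. *)
Lemma fourier_expansion (g : Cinf N) :
  approx (psum (fun k => fcoef g k / RtoC ((2 * PI) ^ N))%C) g.
Proof.
have P : (2 * PI) ^ N <> 0 by apply: pow_nonzero; have := twoPI_gt0; lra.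
have PC : RtoC ((2 * PI) ^ N) <> RtoC 0 by move/RtoC_inj.
have hr : rapid (fun k => fcoef g k / RtoC ((2 * PI) ^ N))%C.
  move=> p; have [K hK] := rapid_fcoef g p; exists (K * Cmod (/ RtoC ((2 * PI) ^ N))%C) => k.
  rewrite Cmod_mult -Rmult_assoc; apply: Rmult_le_compat_r; [exact: Cmod_ge_0|exact: hK].
have [h hh] := synthesis hr.
have E : h = g by apply: fcoef_inj => k; rewrite (fcoef_approx hh); field.
by move: hh; rewrite E.
Qed.

End Synthesis.

(** * The heat-Vekua operator *)

Section Symbol.
Variable n : nat.
Implicit Types (k : 'I_n.+1 -> Z).
Variables (eta : R) (A B : C).

Definition symbol k : C :=
  (eta ^ 2 * \big[Rplus/0]_(j < n) (IZR (k (lift ord0 j)) ^ 2), IZR (k ord0)).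

Lemma symbol_oppk k : symbol (oppk k) = Cconj (symbol k).
Proof.
rewrite /symbol /Cconj /oppk /= opp_IZR; congr (_ * _, _).
by apply: eq_bigr => j _; rewrite opp_IZR /=; ring.
Qed.

(** Stated for abstract coefficient functionals [Phi] so that one computation serves functions,
    through [fcoef], and distributions, through evaluation at exponentials. *)
Lemma fourier_side (V : ModuleSpace C_Ring) (d : 'I_n.+1 -> V -> V) (cj : V -> V)
    (Phi : ('I_n.+1 -> Z) -> V -> C) :
  (forall k u v, Phi k (plus u v) = (Phi k u + Phi k v)%C) ->
  (forall k (c : C) u, Phi k (scal (c : C_Ring) u) = (c * Phi k u)%C) ->
  (forall k j u, Phi k (d j u) = (Ci * RtoC (IZR (k j)) * Phi k u)%C) ->
  (forall k u, Phi k (cj u) = Cconj (Phi (oppk k) u)) ->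
  forall k u, Phi k (heat_vekua_op d cj eta A B u) =
    ((symbol k - A) * Phi k u - B * Cconj (Phi (oppk k) u))%C.
Proof.
move=> hD hZ hd hc k u.
have hN v : Phi k (opp v) = (- Phi k v)%C.
  rewrite -scal_opp_one; transitivity (- (1) * Phi k v)%C; last by ring.
  exact: (hZ k (- (1))%C).
have hB v w : Phi k (minus v w) = (Phi k v - Phi k w)%C by rewrite /minus hD hN.
have h0 : Phi k zero = RtoC 0.
  by rewrite -(scal_zero_r (zero : C_Ring)) (hZ k (RtoC 0)); ring.
have hS : Phi k (\big[plus/zero]_(j < n) d (lift ord0 j) (d (lift ord0 j) u)) =
   (- RtoC (\big[Rplus/0%R]_(j < n) (IZR (k (lift ord0 j)) ^ 2)%R) * Phi k u)%C.
  apply: (big_ind2 (fun v r => Phi k v = (- RtoC r * Phi k u)%C)).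
  - by rewrite h0; ring.
  - by move=> v1 r1 v2 r2 h1 h2; rewrite hD h1 h2 RtoC_plus; ring.
  - move=> j _; rewrite !hd.
    transitivity ((Ci * Ci) * RtoC (IZR (k (lift ord0 j))) * RtoC (IZR (k (lift ord0 j))) * Phi k u)%C; first by ring.
    have -> : (Ci * Ci)%C = (- (1))%C by rewrite /Ci /Cmult /=; apply: injective_projections => /=; ring.
    by rewrite /= Rmult_1_r RtoC_mult; ring.
rewrite /heat_vekua_op /heat_op !hB !hZ hd hS hc.
have -> : symbol k = (Ci * RtoC (IZR (k ord0)) + RtoC (eta ^ 2)%R * RtoC (\big[Rplus/0%R]_(j < n) (IZR (k (lift ord0 j)) ^ 2)%R))%C.
  by rewrite /symbol /Ci; apply: injective_projections => /=; ring.
by ring.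
Qed.

Hypothesis eta0 : 0 < eta.

(** The coordinate realising [knorm k] decides: if it is time, the imaginary part is large; if it is
    a space variable, the real part is at least eta^2 times its square. [K1] serves the first case,
    [K2] the second. *)
Lemma symbol_large (r : R) : exists K : nat, forall k, (K <= knorm k)%N -> r <= Cmod (symbol k).
Proof.
have e2 : 0 < eta ^ 2 by apply: pow_lt.
have [K1 hK1] := nfloor_ex (Rabs r) (Rabs_pos r).
have [K2 hK2] := nfloor_ex (Rabs r / eta ^ 2) (Rle_mult_inv_pos _ _ (Rabs_pos r) e2).
exists (K1 + K2).+1 => k hk.
have [j hj] := knorm_attained (leq_trans (ltn0Sn _) hk).
have r0 := Rle_abs r.
have k1 := pos_INR K1; have k2 := pos_INR K2.
have h1 : INR K1 + INR K2 + 1 <= INR (knorm k).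
  by rewrite -plus_INR -S_INR; apply: le_INR; apply/leP.
move: hj; case: (unliftP ord0 j) => [i ->|->] hj; last first.
  apply: Rle_trans (Rmax_Cmod _); apply: Rle_trans (Rmax_r _ _).
  by rewrite /= Rabs_IZR_abs_nat hj; lra.
apply: Rle_trans (Rmax_Cmod _); apply: Rle_trans (Rmax_l _ _); rewrite /=.
apply: Rle_trans (Rle_abs _).
have h2 : INR (knorm k) ^ 2 <= \big[Rplus/0]_(j < n) (IZR (k (lift ord0 j)) * (IZR (k (lift ord0 j)) * 1)).
  rewrite (bigD1 i) //; apply: (Rle_trans _ (INR (knorm k) ^ 2 + 0)); [lra|apply: Rplus_le_compat].
    by rewrite -hj -Rabs_IZR_abs_nat pow2_abs /=; lra.
  apply: (big_ind (fun a => 0 <= a)) => [|a b|l _] /=; [lra|lra|].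
  by rewrite Rmult_1_r; exact: Rle_0_sqr.
have h3 : INR (knorm k) <= INR (knorm k) ^ 2 by nra.
have h4 : Rabs r <= eta ^ 2 * INR (knorm k).
  have -> : Rabs r = eta ^ 2 * (Rabs r / eta ^ 2) by field; lra.
  by apply: Rmult_le_compat_l; lra.
rewrite -[eta * (eta * 1)]/(eta ^ 2).
have := Rmult_le_compat_l _ _ _ (Rlt_le _ _ e2) (Rle_trans _ _ _ h3 h2) => h5.
exact: Rle_trans r0 (Rle_trans _ _ _ h4 h5).
Qed.

Lemma idx_bounded (K : nat) : exists M : nat, forall k, (knorm k < K)%N -> (idx k < M)%N.
Proof.
have [q hq] := idx_le n.+1; exists ((K + 2) ^ q)%N => k hk.
apply: (@leq_trans (idx k + 2)%N); first by rewrite addn2 ltnS leqnSn.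
apply: leq_trans (hq k) _; case: (q) => [|r]; first by rewrite !expn0.
by rewrite leq_exp2r // leq_add2r ltnW.
Qed.

Lemma bounded_low (a : ('I_n.+1 -> Z) -> C) (K : nat) :
  exists D, 0 <= D /\ forall k, (knorm k < K)%N -> Cmod (a k) <= D.
Proof.
have [M hM] := idx_bounded K.
suff [D [D0 hD]] : exists D, 0 <= D /\ forall k, (idx k < M)%N -> Cmod (a k) <= D.
  by exists D; split => // k /hM /hD.
elim: M {hM} => [|M [D [D0 IH]]]; first by exists 0; split; [lra|].
exists (Rmax D (Cmod (a (kvec M)))); split; first by apply: Rle_trans (Rmax_l _ _).
move=> k; rewrite ltnS leq_eqVlt => /orP [/eqP <-|/IH h].
  by rewrite kvecK; exact: Rmax_r.
by apply: Rle_trans h (Rmax_l _ _).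
Qed.

Lemma apriori (F a : ('I_n.+1 -> Z) -> C) : rapid F ->
  (forall k, F k = ((symbol k - A) * a k - B * Cconj (a (oppk k)))%C) -> rapid a.
Proof.
move=> hF E p.
(* The added 1 makes |sigma| - |A| - |B| at least 1, so the summed inequality gives |a(k)| <= |F(k)|
   + |F(-k)| without division. *)
have [K hK] := symbol_large (Cmod A + Cmod B + 1).
have [D [D0 hD]] := bounded_low a K.
have [H hH] := hF p.
have A0 := Cmod_ge_0 A; have B0 := Cmod_ge_0 B.
exists (2 * Rabs H + (INR K + 2) ^ p * D) => k.
have n0 := pos_INR (knorm k); have K0 := pos_INR K.
have P0 : 0 <= (INR (knorm k) + 2) ^ p by apply: pow_le; lra.
have Q0 : 0 <= (INR K + 2) ^ p by apply: pow_le; lra.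
have H0 := Rabs_pos H; have H1 := Rle_abs H.
case: (ltnP (knorm k) K) => hk.
  have : (INR (knorm k) + 2) ^ p * Cmod (a k) <= (INR K + 2) ^ p * D.
    apply: Rmult_le_compat => //; [exact: Cmod_ge_0| |exact: hD].
    by apply: pow_incr; have := le_INR _ _ (leP (ltnW hk)); lra.
  lra.
have low l : (K <= knorm l)%N -> (Cmod (symbol l) - Cmod A) * Cmod (a l) - Cmod B * Cmod (a (oppk l)) <= Cmod (F l).
  move=> hl; have e1 : (symbol l * a l)%C = (F l + (A * a l + B * Cconj (a (oppk l))))%C by rewrite E; ring.
  have := Cmod_triangle (F l) (A * a l + B * Cconj (a (oppk l)))%C.
  have := Cmod_triangle (A * a l)%C (B * Cconj (a (oppk l)))%C.
  rewrite -e1 !Cmod_mult Cmod_conj; lra.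
have l1 := low k hk.
have := low (oppk k); rewrite knorm_oppk oppkK symbol_oppk Cmod_conj => /(_ hk) l2.
have s := hK k hk.
have a1 := Cmod_ge_0 (a k); have a2 := Cmod_ge_0 (a (oppk k)).
have h : Cmod (a k) <= Cmod (F k) + Cmod (F (oppk k)) by nra.
have f1 := hH k; have := hH (oppk k); rewrite knorm_oppk => f2.
have := Rmult_le_compat_l _ _ _ P0 h.
have : 0 <= (INR K + 2) ^ p * D by apply: Rmult_le_pos.
lra.
Qed.

(** The determinant of the linear system for a(k) and conj(a(-k)). *)
Definition delta k : C := ((symbol k - A) * (symbol k - Cconj A) - B * Cconj B)%C.

(** Both sigma - A and sigma - conj A have modulus at least |B| + 1, so their product exceeds
    |B|^2. *)
Lemma delta_neq0 k : Cmod A + Cmod B + 1 <= Cmod (symbol k) -> delta k <> RtoC 0.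
Proof.
move=> h E.
have B0 := Cmod_ge_0 B.
have e : ((symbol k - A) * (symbol k - Cconj A))%C = (B * Cconj B)%C.
  transitivity (delta k + B * Cconj B)%C; first by rewrite /delta; ring.
  by rewrite E; ring.
have low z : Cmod z = Cmod A -> Cmod B + 1 <= Cmod (symbol k - z)%C.
  move=> hz; have := Cmod_triangle (symbol k - z)%C z.
  have -> : (symbol k - z + z)%C = symbol k by ring.
  lra.
have := congr1 Cmod e; rewrite !Cmod_mult Cmod_conj.
have h1 := low A erefl; have h2 := low _ (Cmod_conj A); nra.
Qed.

Lemma symbol_solve (F : ('I_n.+1 -> Z) -> C) k : delta k <> RtoC 0 ->
  let a k := (((symbol k - Cconj A) * F k + B * Cconj (F (oppk k))) / delta k)%C in
  ((symbol k - A) * a k - B * Cconj (a (oppk k)))%C = F k.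
Proof.
move=> d0 a.
(* Conjugation exchanges the determinants at k and -k, so conj(a(-k)) has the denominator of a(k)
   and is the second component in Cramer's rule. *)
have dc : delta (oppk k) = Cconj (delta k).
  by rewrite /delta symbol_oppk !(Cminus_conj, Cmult_conj, Cconj_conj); ring.
have E : Cconj (a (oppk k)) = (((symbol k - A) * Cconj (F (oppk k)) + Cconj B * F k) / delta k)%C.
  rewrite /a dc oppkK symbol_oppk; move: (delta k) d0 => dk d0.
  rewrite Cdiv_conj; first by rewrite !(Cminus_conj, Cplus_conj, Cmult_conj, Cconj_conj).
  by move=> h; apply: d0; rewrite -(Cconj_conj dk) h; apply: injective_projections => /=; ring.
rewrite E /a; transitivity ((((symbol k - A) * (symbol k - Cconj A) - B * Cconj B) * F k) / delta k)%C.
  by field.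
by rewrite -/(delta k); field.
Qed.

End Symbol.

(** [approx] gives one constant per derivative word, while a neighbourhood in [Cinf_nbhs] tests all
    words up to some length; these being finitely many, one constant suffices. *)
Lemma uniform_order (N : nat) (Q : seq 'I_N -> R -> Prop) :
  (forall s a b, a <= b -> Q s a -> Q s b) -> (forall s, exists a, Q s a) ->
  forall m, exists a, forall s, (size s <= m)%N -> Q s a.
Proof.
move=> mono ex.
have H m : forall Q : seq 'I_N -> R -> Prop, (forall s a b, a <= b -> Q s a -> Q s b) ->
    (forall s, exists a, Q s a) -> exists a, forall s, size s = m -> Q s a.
  elim: m => [|m IH] {mono ex}Q mono ex; first by have [a ha] := ex [::]; exists a => s /size0nil ->.
  have [|j|a ha] := @finite_bound N (fun j a => forall s, size s = m -> Q (j :: s) a).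
  - by move=> j a b ab h s /h; exact: mono.
  - by apply: (IH (fun s => Q (j :: s))) => [s a b|s]; [exact: mono|exact: ex].
  - by exists a => -[//|j s] [hs]; exact: ha.
elim => [|m [a IH]].
  by have [a ha] := H 0%N Q mono ex; exists a => s; rewrite leqn0 => /eqP /ha.
have [b hb] := H m.+1 Q mono ex; exists (Rmax a b) => s.
rewrite leq_eqVlt => /orP [/eqP /hb|]; first by apply: mono; exact: Rmax_r.
by rewrite ltnS => /IH; apply: mono; exact: Rmax_l.
Qed.

Lemma distr_approx (N : nat) (u : distr N) (f : nat -> Cinf N) (g : Cinf N) : approx f g ->
  forall e, 0 < e -> exists M0, forall M, (M0 <= M)%N -> Cmod (u (f M) - u g)%C < e.
Proof.
move=> h e e0.
have L : locally (u g) (fun z => Cmod (z - u g)%C < e).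
  (* Balls of C are measured coordinatewise, so passing to the modulus costs sqrt 2 < 2. *)
  have e2 : 0 < e / 2 by lra.
  exists (mkposreal _ e2) => z [h1 h2].
  apply: Rle_lt_trans (Cmod_2Rmax _) _.
  have m : Rmax (Rabs (z - u g)%C.1) (Rabs (z - u g)%C.2) < e / 2 by apply: Rmax_lub_lt.
  have s2 : sqrt 2 < 2.
    by rewrite -{2}(sqrt_square 2); [apply: sqrt_lt_1; lra|lra].
  have m0 := Rle_trans _ _ _ (Rabs_pos (z - u g)%C.1) (Rmax_l _ (Rabs (z - u g)%C.2)).
  have := sqrt_pos 2; nra.
have [m [d hd]] := dfun_cont L.
have [||K hK] := @uniform_order N (fun s K => 0 <= K /\ forall M x,
     Cmod (partials s (f M) x - partials s g x)%C <= K / (INR M + 1)) _ _ m.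
- move=> s a b ab [a0 ha]; split; first lra.
  move=> M x; apply: Rle_trans (ha M x) _; apply: Rmult_le_compat_r => //.
  by apply: Rlt_le; apply: Rinv_0_lt_compat; have := pos_INR M; lra.
- by move=> s; exact: h.
have [M0 hM0] := rate_lt K (cond_pos d).
exists M0 => M hM; apply: hd => s x hs; have [K0 h1] := hK s hs.
by apply: Rle_lt_trans (h1 M x) _; apply: Rle_lt_trans (rate_le K0 hM) _.
Qed.

(** Both sides are linear and agree on exponentials, hence on the Fourier partial sums of [phi];
    continuity of [u] and [torus_int_approx] carry this to the limit. *)
Lemma distr_eq_torus_int (N : nat) (u : distr N) (g : Cinf N) :
  (forall k, u (expC k) = fcoef g (oppk k)) ->
  forall phi, u phi = torus_int (fun x => g x * phi x)%C.
Proof.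
move=> E phi.
have hphi := fourier_expansion phi; set c := fun k => _ in hphi.
have eqM M : u (psum c M) = torus_int (fun x => psum c M x * g x)%C.
  elim: M => [|M IH].
    rewrite /psum big_ord0.
    have -> : (zero : Cinf_ModuleSpace N) = scal (RtoC 0 : C_Ring) (zero : Cinf_ModuleSpace N).
      by rewrite scal_zero_r.
    rewrite dfun_scal Cmult_0_l.
    have := @torus_int_scal N (RtoC 0) (fun _ => RtoC 0) (@cctn_const N (RtoC 0)).
    rewrite [RHS]Cmult_0_l => H; rewrite -[LHS]H; congr torus_int.
    by apply: functional_extensionality => x /=; ring.
  rewrite psumS dfun_plus dfun_scal IH E /fcoef oppkK.
  rewrite -torus_int_scal; last by apply: cctn_mult; [exact: cctn_Cinf|exact: cctn_expo].
  rewrite -torus_int_plus; last first.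
  - by apply: cctn_mult; [exact: cctn_const|apply: cctn_mult; [exact: cctn_Cinf|exact: cctn_expo]].
  - by apply: cctn_mult; exact: cctn_Cinf.
  by congr torus_int; apply: functional_extensionality => x /=; ring.
have -> : (fun x => g x * phi x)%C = (fun x => phi x * g x)%C.
  by apply: functional_extensionality => x; ring.
have [K hK] := torus_int_approx hphi (cctn_Cinf g) (bounded_periodic (cctn_Cinf g) (cfun_periodic g)).
set J := torus_int _ in hK *.
have Z : (u phi - J)%C = RtoC 0.
  apply: Cmod_eq_0; apply: Rle_antisym; last exact: Cmod_ge_0.
  apply: le_epsilon => e e0; rewrite Rplus_0_l.
  have e2 : 0 < e / 2 by lra.
  have [M1 h1] := distr_approx u hphi e2.
  have [M2 h2] := rate_lt K e2.
  have K0 : 0 <= K.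
    by have := hK 0%N; rewrite -[INR 0]/0 Rplus_0_l Rdiv_1_r; apply: Rle_trans; exact: Cmod_ge_0.
  have b1 := h1 (maxn M1 M2) (leq_maxl _ _).
  have b2 := hK (maxn M1 M2); rewrite -eqM in b2.
  have b3 := rate_le K0 (leq_maxr M1 M2).
  set w := u (psum c _) in b1 b2.
  have -> : (u phi - J)%C = (- (w - u phi) + (w - J))%C by ring.
  by apply: Rle_trans (Cmod_triangle _ _) _; rewrite Cmod_opp; lra.
transitivity ((u phi - J) + J)%C; first by ring.
by rewrite Z; ring.
Qed.

(** * Hypoellipticity and solvability *)

Section MainTheorem.
Variables (n : nat) (A B : C) (eta : R).
Hypothesis eta0 : 0 < eta.

Lemma volume_neq0 : RtoC ((2 * PI) ^ n.+1) <> RtoC 0.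
Proof. by move/RtoC_inj; apply: pow_nonzero; have := twoPI_gt0; lra. Qed.

Lemma Cinf_of_fcoef (a : ('I_n.+1 -> Z) -> C) : rapid a ->
  exists g : Cinf n.+1, forall k, fcoef g k = a k.
Proof.
move=> ha; have V0 := volume_neq0.
have hr : rapid (fun k => a k / RtoC ((2 * PI) ^ n.+1))%C.
  move=> p; have [K hK] := ha p; exists (K * Cmod (/ RtoC ((2 * PI) ^ n.+1))%C) => k.
  by rewrite Cmod_mult -Rmult_assoc; apply: Rmult_le_compat_r; [exact: Cmod_ge_0|exact: hK].
have [g hg] := synthesis hr; exists g => k; rewrite (fcoef_approx hg); field; exact: V0.
Qed.

Lemma fcoef_heat_vekua (g : Cinf n.+1) k :
  fcoef (Cinf_heat_vekua eta A B g) k = ((symbol eta k - A) * fcoef g k - B * Cconj (fcoef g (oppk k)))%C.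
Proof.
apply: (@fourier_side n eta A B (Cinf_ModuleSpace n.+1) _ _ (fun k (v : Cinf n.+1) => fcoef v k)).
- by move=> l u v; apply: fcoef_plus; exact: cctn_Cinf.
- by move=> l c u; apply: fcoef_scal; exact: cctn_Cinf.
- by move=> l j u; exact: fcoef_partial.
- by move=> l u; apply: fcoef_conj; exact: cctn_Cinf.
Qed.

Lemma distr_heat_vekua_expC (u : distr n.+1) k :
  distr_heat_vekua eta A B u (expC (oppk k)) =
  ((symbol eta k - A) * u (expC (oppk k)) - B * Cconj (u (expC (oppk (oppk k)))))%C.
Proof.
apply: (@fourier_side n eta A B (distr_ModuleSpace n.+1) _ _ (fun k (v : distr n.+1) => v (expC (oppk k)))).
- by [].
- by [].
(* The minus sign of the distributional derivative cancels the one from the frequency -k of the test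
   function. *)
- move=> l j v /=; rewrite partial_expC dfun_scal /oppk opp_IZR RtoC_opp; ring.
- by move=> l v /=; rewrite conj_expC.
Qed.

Lemma heat_vekua_hypoelliptic : globally_hypoelliptic (@distr_heat_vekua n eta A B).
Proof.
move=> u [f hf].
have E k : fcoef f k = ((symbol eta k - A) * u (expC (oppk k)) - B * Cconj (u (expC (oppk (oppk k)))))%C.
  by rewrite -distr_heat_vekua_expC hf.
have ra := apriori eta0 (rapid_fcoef f) (a := fun k => u (expC (oppk k))) E.
have [g hg] := Cinf_of_fcoef ra; exists g; apply: distr_eq_torus_int => k.
by rewrite hg oppkK.
Qed.

Lemma heat_vekua_solvable : solvable (@Cinf_heat_vekua n eta A B).
Proof.
have [K hK] := symbol_large n eta0 (Cmod A + Cmod B + 1).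
have [M hM] := idx_bounded n K.
(* The exceptional set is enlarged to an initial segment of the enumeration, so that subtracting the
   partial sum [psum] of length [M] projects onto the subspace. *)
exists (fun f => forall k, (idx k < M)%N -> fcoef f k = RtoC 0); split; [|split].
- split; [|split].
  + move=> k _; have := @fcoef_scal n.+1 (RtoC 0) (Cinf_zero n.+1) k (cctn_Cinf _).
    rewrite Cmult_0_l => <-; congr fcoef; apply: functional_extensionality => x /=; ring.
  + move=> f g hf hg k hk; rewrite (@fcoef_plus _ f g) ?hf ?hg //; try exact: cctn_Cinf; ring.
  + move=> c f hf k hk; rewrite (@fcoef_scal _ c f) ?hf //; last exact: cctn_Cinf.
    exact: Cmult_0_r.
- pose c (v : Cinf n.+1) k := (fcoef v k / RtoC ((2 * PI) ^ n.+1))%C.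
  exists M, (fun i => expC (@kvec n.+1 i)) => v; exists (fun i => mterm (c v) i) => k hk.
  rewrite -/(psum (c v) M).
  have := @fcoef_plus _ v (fun x => - (1) * psum (c v) M x)%C k (cctn_Cinf v).
  move=> H; rewrite [LHS]H {H}; last by apply: cctn_mult; [exact: cctn_const|exact: cctn_Cinf].
  rewrite fcoef_scal ?fcoef_psum ?hk; last exact: cctn_Cinf.
  by rewrite /c; field; exact: volume_neq0.
- move=> f hf.
  pose b k := (((symbol eta k - Cconj A) * fcoef f k + B * Cconj (fcoef f (oppk k))) / delta eta A B k)%C.
  (* At exceptional frequencies the right side vanishes and [a] is set to 0; [knorm] is even in k,
     so the frequencies k and -k fall under the same case. *)
  pose a k := if (knorm k < K)%N then RtoC 0 else b k.
  have E k : fcoef f k = ((symbol eta k - A) * a k - B * Cconj (a (oppk k)))%C.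
    rewrite /a knorm_oppk; case: ltnP => hk.
      rewrite hf; last exact: hM.
      by apply: injective_projections => /=; ring.
    by symmetry; apply: symbol_solve; apply: delta_neq0; exact: hK.
  (* The decay of [a] is read off from the equation it solves, by the same estimate as for
     hypoellipticity, instead of from its formula. *)
  have [u hu] := Cinf_of_fcoef (apriori eta0 (rapid_fcoef f) E).
  by exists u; apply: fcoef_inj => k; rewrite fcoef_heat_vekua !hu E.
Qed.

End MainTheorem.

Theorem theorem5 (n : nat) (hn : (1 <= n)%N) (A B : C) (eta : R)
    (heta : (0 < eta)%R) :
  solvable (@Cinf_heat_vekua n eta A B) /\
  globally_hypoelliptic (@distr_heat_vekua n eta A B).
Proof. by split; [exact: heat_vekua_solvable|exact: heat_vekua_hypoelliptic]. Qed.
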